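(* Let $V$ be a vertex operator algebra with two commuting automorphisms $g_1,g_2$ of finite order, and set $g_3=g_1g_2$. Let $W^1$ and $W^2$ be $C_1$-cofinite generalized $g_1$-twisted and $g_2$-twisted $V$-modules, respectively. Then for any $(U,\mathcal{Y})\in\mathcal{F}_{(W^1,W^2)}$ (that is, $U$ is a generalized $g_3$-twisted $V$-module and $\mathcal{Y}$ is a surjective twisted logarithmic intertwining operator of type $\binom{U}{W^1\ W^2}$), $$\dim\left(U/C_1(U)\right)\le \dim\left(W^1/C_1(W^1)\right)\,\dim\left(W^2/C_1(W^2)\right).$$ In particular, $U$ is $C_1$-cofinite.
   Context: Vertex operator algebras $(V,Y,\mathbf 1,\omega)$ are over $\mathbb{C}$, in the standard (Frenkel-Huang-Lepowsky) sense; $\mathbb{N}$ contains $0$. Twisted modules. Let $g$ be an automorphism of $V$ of finite order $T$, and let $V^{(g,r)}=\{v\in V\mid gv=e^{-2\pi \mathrm{i} r/T}v\}$, $0\le r\le T-1$. A weak $g$-twisted $V$-module (also called $g$-twisted $V$-module) is a vector space $W$ with a linear map $Y_W(-,x):V\to \mathrm{End}(W)[[x^{1/T},x^{-1/T}]]$, $v\mapsto Y_W(v,x)=\sum_{n\in\frac1T\mathbb{Z}}v_nx^{-n-1}$, such that: $Y_W(\mathbf 1,x)=\mathrm{id}_W$; $Y_W(u,x)w\in x^{r/T}W((x))$ for $u\in V^{(g,r)}$, $w\in W$; and for $v\in V^{(g,r)}$, $u\in V$, $$x_0^{-1}\delta\left(\tfrac{x_1-x_2}{x_0}\right)Y_W(v,x_1)Y_W(u,x_2)-x_0^{-1}\delta\left(\tfrac{x_2-x_1}{-x_0}\right)Y_W(u,x_2)Y_W(v,x_1)=x_1^{-1}\delta\left(\tfrac{x_2+x_0}{x_1}\right)\left(\tfrac{x_2+x_0}{x_1}\right)^{-r/T}Y_W(Y(v,x_0)u,x_2).$$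 Write $Y_W(\omega,x)=\sum_n L(n)x^{-n-2}$ and $W_{(\lambda)}=\{w\in W\mid (L(0)-\lambda)^kw=0\text{ for some }k\in\mathbb{N}\}$. A generalized $g$-twisted $V$-module is a weak one with $W=\bigoplus_{\lambda\in\mathbb{C}}W_{(\lambda)}$ such that for each $\lambda\in\mathbb{C}$, $W_{(\lambda+n/T)}=0$ for all sufficiently negative integers $n$. $C_1$-cofiniteness. $C_1(W)$ is the span of all $v_{-1}w$ with $v\in V^{(g,0)}$ homogeneous, $\mathrm{wt}\,v>0$, $w\in W$, together with all $v_{-1-r/T}w$ with $v\in V^{(g,r)}$ homogeneous, $r=1,\dots,T-1$, $\mathrm{wt}\,v\ge 0$, $w\in W$. $W$ is $C_1$-cofinite if $\dim W/C_1(W)<\infty$. Twisted logarithmic intertwining operators. Let $T_k$ be the order of $g_k$ ($k=1,2,3$) and $V^{(r_1,r_2)}=\{v\mid g_kv=e^{-2\pi \mathrm{i} r_k/T_k}v,\ k=1,2\}$ for $0\le r_k<T_k$. For $g_k$-twisted modules $W^k$, a twisted logarithmic intertwining operator of type $\binom{W^3}{W^1\ W^2}$ is a linear map $\mathcal{Y}(-,x):W^1\otimes W^2\to W^3[\log x]\{x\}$, $\mathcal{Y}(w^1,x)w^2=\sum_{n\in\mathbb{C}}\sum_{k\in\mathbb{N}}(w^1)^{\mathcal{Y}}_{n;k}w^2\,x^{-n-1}(\log x)^k$ ($\{x\}$ denotes formal series in arbitrary complex powers of $x$) such that: (i) for all $w^1,w^2$ and $h\in\mathbb{C}$, $(w^1)^{\mathcal{Y}}_{h+n;k}w^2=0$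 for $n\in\mathbb{N}$ sufficiently large, independently of $k$; (ii) for $v\in V^{(r_1,r_2)}$, $$x_0^{-1}\delta\left(\tfrac{x_1-x_2}{x_0}\right)\left(\tfrac{x_1-x_2}{x_0}\right)^{-r_1/T_1}Y_{W^3}(v,x_1)\mathcal{Y}(w^1,x_2)w^2-x_0^{-1}\delta\left(\tfrac{-x_2+x_1}{x_0}\right)\left(\tfrac{-x_2+x_1}{x_0}\right)^{-r_1/T_1}\mathcal{Y}(w^1,x_2)Y_{W^2}(v,x_1)w^2$$ $$=x_1^{-1}\delta\left(\tfrac{x_2+x_0}{x_1}\right)\left(\tfrac{x_2+x_0}{x_1}\right)^{-r_2/T_2}\mathcal{Y}(Y_{W^1}(v,x_0)w^1,x_2)w^2,$$ where $(-x)^\alpha$ means $e^{\pi \mathrm{i}\alpha}x^\alpha$; (iii) $\mathcal{Y}(L(-1)w^1,x)=\frac{d}{dx}\mathcal{Y}(w^1,x)$. $\mathcal{I}\binom{W^3}{W^1\ W^2}$ denotes the space of these operators. $\mathrm{Im}\,\mathcal{Y}$ is the span of all coefficients $(w^1)^{\mathcal{Y}}_{n;k}w^2$, and $\mathcal{Y}$ is surjective if $\mathrm{Im}\,\mathcal{Y}=W^3$. $\mathcal{F}_{(W^1,W^2)}$ is the set of pairs $(U,\mathcal{Y})$ with $U$ a generalized $g_3$-twisted $V$-module and $\mathcal{Y}\in\mathcal{I}\binom{U}{W^1\ W^2}$ surjective, modulo: $(U,\mathcal{Y}_1)\cong(W,\mathcal{Y}_2)$ if there is an isomorphism $f:U\to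 W$ of $g_3$-twisted $V$-modules with $f\circ\mathcal{Y}_1=\mathcal{Y}_2$. *)

(* Defs.v *)
(* The field of complex numbers is R[i] for a realType R. *)
From HB Require Import structures.
From mathcomp Require Import all_boot all_order all_algebra.
From mathcomp Require Import all_classical all_reals all_analysis.
From mathcomp.real_closed Require Import complex.
Set Implicit Arguments.
Unset Strict Implicit.
Unset Printing Implicit Defensive.
Import Order.TTheory GRing.Theory Num.Theory.
Local Open Scope classical_set_scope.
Local Open Scope ring_scope.

Definition is_subspace (R : realType) (W : lmodType R[i]) (S : set W) : Prop :=
  S 0 /\ forall (a : R[i]) (u v : W), S u -> S v -> S (a *: u + v).

Definition lspan (R : realType) (W : lmodType R[i]) (A : set W) : set W :=
  smallest (@is_subspace R W) A.

Definition direct_sum (R : realType) (W : lmodType R[i]) (I : choiceType)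
    (S : I -> set W) : Prop :=
  (forall i, is_subspace (S i)) /\
  forall w : W, exists! f : I -> W,
    [/\ forall i, S i (f i), finite_set [set i | f i != 0]
      & w = \sum_(i \in [set: I]) f i].

(* For a subspace S: dim (W / S) = n, i.e. the classes modulo S of some
   b_0, ..., b_(n-1) form a basis of W / S. *)
Definition has_quotient_dim (R : realType) (W : lmodType R[i]) (S : set W)
    (n : nat) : Prop :=
  exists b : 'I_n -> W, forall w : W,
    exists! c : {ffun 'I_n -> R[i]}, S (w - \sum_(i < n) c i *: b i).

Definition finite_quotient (R : realType) (W : lmodType R[i]) (S : set W)
    : Prop :=
  exists n, has_quotient_dim S n.

(* dim (W / S); the value is 0 by convention when W / S is infinite
   dimensional, so it is meant to be read together with finite_quotient. *)
Definition quotient_dim (R : realType) (W : lmodType R[i]) (S : set W) : nat :=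
  xget 0%N [set n | has_quotient_dim S n].

(* e^(pi i t) *)
Definition exp_ipi (R : realType) (t : R) : R[i] :=
  Complex (cos (pi * t)) (sin (pi * t)).

(* The scalar by which (-x)^t (if s) or x^t (if not) differs from x^t, with the
   convention (-x)^t = e^(pi i t) x^t. *)
Definition sign_pow (R : realType) (s : bool) (t : R) : R[i] :=
  if s then exp_ipi t else 1.

Definition gbinom (R : realType) (t : R) (k : nat) : R :=
  (\prod_(i < k) (t - i%:R)) / k`!%:R.

(* A formal series in three variables with arbitrary complex exponents is the
   function sending exponents to coefficients.  For F(x, y, z) such a series,
   delta_mul sx sy sz alpha F is
     x^-1 delta((+-y +- z)/(+-x)) ((+-y +- z)/(+-x))^alpha F(x, y, z)
   where sx, sy, sz tell which of x, y, z carry a minus sign; it is obtained by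
   expanding, in nonnegative integral powers of z,
     sum_(n in Z) x^-1 (+-x)^(-beta) (+-y +- z)^beta F    (beta = n + alpha)
   = sum_(n, k) binom(beta, k) x^-1 (+-x)^(-beta) (+-y)^(beta - k) (+-z)^k F.
   The sum below has finite support in all the uses, by lower truncation. *)
Definition delta_mul (R : realType) (W : lmodType R[i]) (sx sy sz : bool)
    (alpha : R) (F : R[i] -> R[i] -> R[i] -> W) (a b c : R[i]) : W :=
  \sum_(p \in [set: int * nat])
    let beta : R := p.1%:~R + alpha in
    let k : nat := p.2 in
    ((gbinom beta k)%:C%C * sign_pow sx (- beta)
       * sign_pow sy (beta - k%:R) * sign_pow sz (k%:R : R))
    *: F (a + 1 + beta%:C%C) (b - beta%:C%C + k%:R) (c - k%:R).

(* The coefficient of x^e in w, seen as a constant series in x. *)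
Definition const_coef (R : realType) (W : lmodType R[i]) (e : R[i]) (w : W)
    : W :=
  if e == 0 then w else 0.

(* Vertex operators are given by their modes: Y u n w stands for u_n w, where
   Y(u, x) w = sum_n u_n w x^(-n-1).  All modes are indexed by complex numbers;
   modes with index outside Z (resp. (1/T)Z) will be required to vanish.
   coef Y u e w is the coefficient of x^e in Y(u, x) w. *)
Definition coef (R : realType) (A B D : Type) (Y : A -> R[i] -> B -> D)
    (u : A) (e : R[i]) (w : B) : D :=
  Y u (- e - 1) w.

(* L(m) = omega_(m+1) *)
Definition vir (R : realType) (A B : Type) (Y : A -> R[i] -> B -> B) (omega : A)
    (m : int) : B -> B :=
  Y omega (m%:~R + 1).

Record voa (R : realType) := VOA {
  voa_car :> lmodType R[i];
  vmode : voa_car -> R[i] -> voa_car -> voa_car;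
  vacuum : voa_car;
  conformal : voa_car;
  rank : R[i];
  (* vwt n is V_(n), the space of vectors of weight n *)
  vwt : int -> set voa_car;
  voa_linear_l : forall n v, linear (fun u => vmode u n v);
  voa_linear_r : forall u n, linear (vmode u n);
  voa_integral : forall u n v, vmode u n v != 0 -> exists m : int, n = m%:~R;
  voa_truncation : forall u v, exists N : int,
    forall m : int, N <= m -> vmode u m%:~R v = 0;
  voa_graded : direct_sum vwt;
  voa_finite : forall n, exists (d : nat) (b : 'I_d -> voa_car),
    forall v, vwt n v ->
      exists c : 'I_d -> R[i], v = \sum_(i < d) c i *: b i;
  voa_bounded : exists N : int, forall n v, n < N -> vwt n v -> v = 0;
  voa_vacuum_wt : vwt 0 vacuum;
  voa_conformal_wt : vwt 2 conformal;
  voa_vacuum : forall n v, vmode vacuum n v = if n == -1 then v else 0;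
  voa_creation : forall u,
    vmode u (-1) vacuum = u /\ forall m : nat, vmode u m%:R vacuum = 0;
  (* x0^-1 delta((x1-x2)/x0) Y(u,x1) Y(v,x2) w
       - x0^-1 delta((x2-x1)/(-x0)) Y(v,x2) Y(u,x1) w
     = x2^-1 delta((x1-x0)/x2) Y(Y(u,x0)v,x2) w *)
  voa_jacobi : forall (u v w : voa_car) (a0 a1 a2 : R[i]),
    delta_mul false false true 0
      (fun e0 e1 e2 => const_coef e0 (coef vmode u e1 (coef vmode v e2 w)))
      a0 a1 a2
    - delta_mul true false true 0
      (fun e0 e2 e1 => const_coef e0 (coef vmode v e2 (coef vmode u e1 w)))
      a0 a2 a1
    = delta_mul false false true 0
      (fun e2 e1 e0 => const_coef e1 (coef vmode (coef vmode u e0 v) e2 w))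
      a2 a1 a0;
  voa_virasoro : forall (m n : int) v,
    let L := vir vmode conformal in
    L m (L n v) - L n (L m v) =
      (m - n)%:~R *: L (m + n) v
      + (if m + n == 0 then ((m ^+ 3 - m)%:~R / 12%:R * rank) *: v else 0);
  voa_L0 : forall n v, vwt n v -> vir vmode conformal 0 v = n%:~R *: v;
  (* Y(L(-1)u, x) = d/dx Y(u, x) *)
  voa_Lm1 : forall u n v,
    vmode (vir vmode conformal (-1) u) n v = (- n) *: vmode u (n - 1) v
}.

Definition voa_automorphism (R : realType) (V : voa R) (g : V -> V) : Prop :=
  [/\ linear g, bijective g,
      forall u n v, g (vmode u n v) = vmode (g u) n (g v),
      g (vacuum V) = vacuum V & g (conformal V) = conformal V].

Definition has_order (A : Type) (g : A -> A) (T : nat) : Prop :=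
  [/\ (0 < T)%N, iter T g =1 id
    & forall n, (0 < n)%N -> iter n g =1 id -> (T <= n)%N].

(* V^(g,r), for g of order T *)
Definition eigen (R : realType) (V : voa R) (g : V -> V) (T r : nat) : set V :=
  [set v | g v = exp_ipi (- (2%:R * r%:R / T%:R)) *: v].

(* Weak g-twisted V-modules, for g of order T. *)
Record twisted_module (R : realType) (V : voa R) (g : V -> V) (T : nat) :=
  TwistedModule {
  tw_car :> lmodType R[i];
  wmode : V -> R[i] -> tw_car -> tw_car;
  tw_linear_l : forall n w, linear (fun v => wmode v n w);
  tw_linear_r : forall v n, linear (wmode v n);
  tw_support : forall v n w,
    wmode v n w != 0 -> exists m : int, n = m%:~R / T%:R;
  tw_vacuum : forall n w, wmode (vacuum V) n w = if n == -1 then w else 0;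
  tw_truncation : forall (r : nat) (u : V) (w : tw_car),
    (r < T)%N -> eigen g T r u ->
    exists N : int, forall e : R[i], coef wmode u e w != 0 ->
      exists m : int, N <= m /\ e = r%:R / T%:R + m%:~R;
  (* x0^-1 delta((x1-x2)/x0) Y(v,x1) Y(u,x2) w
       - x0^-1 delta((x2-x1)/(-x0)) Y(u,x2) Y(v,x1) w
     = x1^-1 delta((x2+x0)/x1) ((x2+x0)/x1)^(-r/T) Y(Y(v,x0)u,x2) w *)
  tw_jacobi : forall (r : nat) (v u : V) (w : tw_car) (a0 a1 a2 : R[i]),
    (r < T)%N -> eigen g T r v ->
    delta_mul false false true 0
      (fun e0 e1 e2 => const_coef e0 (coef wmode v e1 (coef wmode u e2 w)))
      a0 a1 a2
    - delta_mul true false true 0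
      (fun e0 e2 e1 => const_coef e0 (coef wmode u e2 (coef wmode v e1 w)))
      a0 a2 a1
    = delta_mul false false false (- (r%:R / T%:R))
      (fun e1 e2 e0 => const_coef e1 (coef wmode (coef (@vmode R V) v e0 u) e2 w))
      a1 a2 a0
}.

Definition wvir (R : realType) (V : voa R) (g : V -> V) (T : nat)
    (W : twisted_module g T) (m : int) : W -> W :=
  vir (@wmode R V g T W) (conformal V) m.

(* W_(lambda) *)
Definition gen_weight (R : realType) (V : voa R) (g : V -> V) (T : nat)
    (W : twisted_module g T) (lambda : R[i]) : set W :=
  [set w | exists k : nat, iter k (fun w' => wvir 0 w' - lambda *: w') w = 0].

Arguments gen_weight {R V g T} W lambda _.

Definition generalized (R : realType) (V : voa R) (g : V -> V) (T : nat)
    (W : twisted_module g T) : Prop :=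
  direct_sum (gen_weight W) /\
  forall lambda : R[i], exists N : int, forall n : int, n <= N ->
    gen_weight W (lambda + n%:~R / T%:R) = [set 0].

Definition C1 (R : realType) (V : voa R) (g : V -> V) (T : nat)
    (W : twisted_module g T) : set W :=
  lspan
    ([set w' | exists (n : int) (v : V) (w : W),
        [/\ 0 < n, vwt n v, eigen g T 0 v & w' = wmode v (-1) w]] `|`
     [set w' | exists (r : nat) (n : int) (v : V) (w : W),
        [/\ (0 < r < T)%N, 0 <= n, vwt n v, eigen g T r v
          & w' = wmode v (-1 - r%:R / T%:R) w]]).

Arguments C1 {R V g T} W _.

Definition C1_cofinite (R : realType) (V : voa R) (g : V -> V) (T : nat)
    (W : twisted_module g T) : Prop :=
  finite_quotient (C1 W).

Definition dim_mod_C1 (R : realType) (V : voa R) (g : V -> V) (T : nat)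
    (W : twisted_module g T) : nat :=
  quotient_dim (C1 W).

(* Twisted logarithmic intertwining operators of type (W3 over W1 W2), with
   g3 = g1 g2.  imode k w1 n w2 is the coefficient (w1)_(n;k) w2 of
   x^(-n-1) (log x)^k in Y(w1, x) w2. *)
Record intertwining (R : realType) (V : voa R) (g1 g2 : V -> V)
    (T1 T2 T3 : nat) (W1 : twisted_module g1 T1) (W2 : twisted_module g2 T2)
    (W3 : twisted_module (g1 \o g2) T3) := Intertwining {
  imode : nat -> W1 -> R[i] -> W2 -> W3;
  int_linear_l : forall k n w2, linear (fun w1 => imode k w1 n w2);
  int_linear_r : forall k w1 n, linear (imode k w1 n);
  (* each power of x has a coefficient that is polynomial in log x *)
  int_log : forall w1 w2 n, exists K : nat, forall k, (K <= k)%N ->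
    imode k w1 n w2 = 0;
  int_truncation : forall w1 w2 (h : R[i]), exists N : nat,
    forall n : nat, (N <= n)%N -> forall k, imode k w1 (h + n%:R) w2 = 0;
  (* the coefficient of (log x2)^k in
     x0^-1 delta((x1-x2)/x0) ((x1-x2)/x0)^(-r1/T1) Y3(v,x1) Y(w1,x2) w2
       - x0^-1 delta((-x2+x1)/x0) ((-x2+x1)/x0)^(-r1/T1) Y(w1,x2) Y2(v,x1) w2
     = x1^-1 delta((x2+x0)/x1) ((x2+x0)/x1)^(-r2/T2) Y(Y1(v,x0)w1,x2) w2 *)
  int_jacobi : forall (r1 r2 : nat) (v : V) (w1 : W1) (w2 : W2) (k : nat)
      (a0 a1 a2 : R[i]),
    (r1 < T1)%N -> (r2 < T2)%N -> eigen g1 T1 r1 v -> eigen g2 T2 r2 v ->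
    delta_mul false false true (- (r1%:R / T1%:R))
      (fun e0 e1 e2 => const_coef e0
         (coef (@wmode _ _ _ _ W3) v e1 (coef (imode k) w1 e2 w2)))
      a0 a1 a2
    - delta_mul false true false (- (r1%:R / T1%:R))
      (fun e0 e2 e1 => const_coef e0
         (coef (imode k) w1 e2 (coef (@wmode _ _ _ _ W2) v e1 w2)))
      a0 a2 a1
    = delta_mul false false false (- (r2%:R / T2%:R))
      (fun e1 e2 e0 => const_coef e1
         (coef (imode k) (coef (@wmode _ _ _ _ W1) v e0 w1) e2 w2))
      a1 a2 a0;
  (* Y(L(-1)w1, x) = d/dx Y(w1, x), where
     d/dx (x^(-m-1) (log x)^j)
       = (-m-1) x^(-m-2) (log x)^j + j x^(-m-2) (log x)^(j-1) *)
  int_Lm1 : forall k w1 n w2,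
    imode k (wvir (-1) w1) n w2 =
      (- n) *: imode k w1 (n - 1) w2 + k.+1%:R *: imode k.+1 w1 (n - 1) w2
}.

Definition int_image (R : realType) (V : voa R) (g1 g2 : V -> V)
    (T1 T2 T3 : nat) (W1 : twisted_module g1 T1) (W2 : twisted_module g2 T2)
    (W3 : twisted_module (g1 \o g2) T3) (Y : intertwining W1 W2 W3) : set W3 :=
  lspan [set w | exists k w1 n w2, w = imode Y k w1 n w2].

Arguments int_image {R V g1 g2 T1 T2 T3 W1 W2 W3} Y _.

Definition surjective_int (R : realType) (V : voa R) (g1 g2 : V -> V)
    (T1 T2 T3 : nat) (W1 : twisted_module g1 T1) (W2 : twisted_module g2 T2)
    (W3 : twisted_module (g1 \o g2) T3) (Y : intertwining W1 W2 W3) : Prop :=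
  int_image Y = [set: W3].

(* Main.v *)
Require Import Defs.
From mathcomp Require Import all_boot all_order all_algebra.
From mathcomp Require Import all_classical all_reals all_analysis.
From mathcomp.real_closed Require Import complex.
From mathcomp Require Import zify ring lra.

(* Normalise all exponents so that x = 1.  Modulo C_1(U), the Jacobi identity
   expresses Y(v_n w1, 1) w2, for v_n w1 a generator of C_1(W1), through values
   Y(w1', 1) w2' of smaller total weight, and symmetrically for generators of
   C_1(W2).  Hence the values Y(b1_i, 1) b2_j, with b1, b2 homogeneous bases of
   W1 and W2 modulo C_1, span all the values Y(w1, 1) w2 modulo C_1(U).  These
   are infinite sums over the weights of U, so everything is truncated to an
   arbitrary finite set of weights.  Replacing w1 by L(-1) w1 differentiates in
   x, and the derivatives at x = 1 of a finite sum of terms x^l (log x)^k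
   determine each coefficient.  Thus any finite family in U lies, modulo C_1(U),
   in the span of dim(W1/C_1) dim(W2/C_1) vectors. *)

Set Implicit Arguments.
Unset Strict Implicit.
Unset Printing Implicit Defensive.
Import Order.TTheory GRing.Theory Num.Theory.
Local Open Scope classical_set_scope.
Local Open Scope ring_scope.

(** * Linear algebra modulo a subspace *)

Section Subspace.
Context {R : realType} {W : lmodType R[i]}.
Implicit Types (S A : set W).

Lemma subspace0 S : is_subspace S -> S 0.
Proof. by case. Qed.

Lemma subspaceD S u v : is_subspace S -> S u -> S v -> S (u + v).
Proof. by move=> [_ h] Su Sv; rewrite -[u]scale1r; exact: h. Qed.

Lemma subspaceZ S a u : is_subspace S -> S u -> S (a *: u).
Proof. by move=> [S0 h] Su; rewrite -[_ *: _]addr0; exact: h. Qed.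

Lemma subspaceN S u : is_subspace S -> S u -> S (- u).
Proof. by move=> hS Su; rewrite -scaleN1r; exact: subspaceZ. Qed.

Lemma subspaceB S u v : is_subspace S -> S u -> S v -> S (u - v).
Proof. by move=> hS Su Sv; apply: subspaceD => //; exact: subspaceN. Qed.

Lemma subspace_sum S {I : Type} {r : seq I} {P : pred I} {F : I -> W} :
  is_subspace S -> (forall i, P i -> S (F i)) -> S (\sum_(i <- r | P i) F i).
Proof.
move=> hS h; elim/big_ind: _ => //; first exact: subspace0.
by move=> x y; exact: subspaceD.
Qed.

Lemma subspaceDl S u v : is_subspace S -> S v -> S (u + v) -> S u.
Proof. by move=> hS Sv Suv; rewrite -(addrK v u); exact: subspaceB. Qed.

Lemma lspan_subspace A : is_subspace (lspan A).
Proof.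
split=> [M [[]]//|a u v hu hv M hM].
by case: (hM) => -[_ h] _; apply: h; [exact: hu|exact: hv].
Qed.

Lemma sub_lspan A : A `<=` lspan A.
Proof. exact: sub_gen_smallest. Qed.

Lemma lspan_sub A S : is_subspace S -> A `<=` S -> lspan A `<=` S.
Proof. exact: smallest_sub. Qed.

End Subspace.
#[local] Hint Resolve lspan_subspace : core.

Section LinearFun.
Context {R : realType} {W W' : lmodType R[i]} {f : W -> W'} (lf : linear f).

Lemma linfun0 : f 0 = 0.
Proof. by have := lf (-1) 0 0; rewrite scaler0 addr0 scaleN1r addNr. Qed.

Lemma linfunZ a u : f (a *: u) = a *: f u.
Proof. by have := lf a u 0; rewrite !addr0 linfun0 addr0. Qed.

Lemma linfunD u v : f (u + v) = f u + f v.
Proof. by have := lf 1 u v; rewrite !scale1r. Qed.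

Lemma linfunN u : f (- u) = - f u.
Proof. by rewrite -scaleN1r linfunZ scaleN1r. Qed.

Lemma linfunB u v : f (u - v) = f u - f v.
Proof. by rewrite linfunD linfunN. Qed.

Lemma linfun_sum (I : Type) (r : seq I) (P : pred I) (F : I -> W) :
  f (\sum_(i <- r | P i) F i) = \sum_(i <- r | P i) f (F i).
Proof. by elim/big_rec2: _ => [|i x y _ <-]; rewrite ?linfun0 ?linfunD. Qed.

End LinearFun.

Lemma linear_lspan {R : realType} {W W' : lmodType R[i]} (f : W -> W')
    (A : set W) (S : set W') :
  linear f -> is_subspace S -> (forall w, A w -> S (f w)) ->
  forall w, lspan A w -> S (f w).
Proof.
move=> lf hS h; apply: (lspan_sub (S := [set w | S (f w)])) => //; split=> /=.
  by rewrite (linfun0 lf); exact: subspace0.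
by move=> a u v Su Sv /=; rewrite lf; apply: hS.2.
Qed.

Section QuotientDimension.
Context {R : realType} {W : lmodType R[i]}.
Variable S : set W.
Hypothesis hS : is_subspace S.

Definition indep_mod n (b : 'I_n -> W) : Prop :=
  forall c : 'I_n -> R[i], S (\sum_(i < n) c i *: b i) -> forall i, c i = 0.

Definition span_mod n (b : 'I_n -> W) : set W :=
  [set w | exists c : 'I_n -> R[i], S (w - \sum_(i < n) c i *: b i)].

Lemma span_mod_subspace n (b : 'I_n -> W) : is_subspace (span_mod b).
Proof.
split.
  exists (fun=> 0); rewrite sub0r; apply: subspaceN => //.
  by apply: subspace_sum => // i _; rewrite scale0r; exact: subspace0.
move=> a u v [c Sc] [d Sd]; exists (fun i => a * c i + d i).
have -> : a *: u + v - \sum_(i < n) (a * c i + d i) *: b i =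
    a *: (u - \sum_(i < n) c i *: b i) + (v - \sum_(i < n) d i *: b i).
  rewrite scalerBr addrACA -opprD; congr (_ + - _).
  rewrite scaler_sumr -big_split; apply: eq_bigr => i _.
  by rewrite scalerDl scalerA.
exact: hS.2.
Qed.

Lemma sub_span_mod n (b : 'I_n -> W) : S `<=` span_mod b.
Proof.
move=> w Sw; exists (fun=> 0); rewrite big1 ?subr0// => i _.
by rewrite scale0r.
Qed.

Lemma mem_span_mod n (b : 'I_n -> W) i : span_mod b (b i).
Proof.
exists (fun j => (j == i)%:R); rewrite (bigD1 i)//= eqxx scale1r big1.
  by rewrite addr0 subrr; exact: subspace0.
by move=> j /negbTE ->; rewrite scale0r.
Qed.

(** If [m > n], the coordinate matrix has a nonzero vector in its left kernel, whose entries form a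
    nontrivial relation among the [u i] modulo [S]. *)
Lemma indep_mod_leq n (b : 'I_n -> W) m (u : 'I_m -> W) :
  indep_mod u -> (forall i, span_mod b (u i)) -> (m <= n)%N.
Proof.
move=> iu /choice[c hc]; rewrite leqNgt; apply/negP => ltnm.
pose A := \matrix_(i < m, j < n) c i j.
have /eqP : \rank A != m by rewrite neq_ltn (leq_ltn_trans (rank_leq_col A)).
have /rowV0Pn[x /sub_kermxP xA x0 _] : kermx A != 0.
  by rewrite kermx_eq0 /row_free neq_ltn (leq_ltn_trans (rank_leq_col A)).
case/negP: x0; apply/eqP/rowP => i; rewrite mxE; apply: (iu (fun i => x 0 i)).
have -> : \sum_(i < m) x 0 i *: u i =
    \sum_(i < m) x 0 i *: (u i - \sum_(j < n) c i j *: b j).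
  rewrite [RHS](eq_bigr (fun i =>
      x 0 i *: u i - \sum_(j < n) (x 0 i * c i j) *: b j)).
    rewrite sumrB [X in _ - X](_ : _ = 0) ?subr0//.
    rewrite exchange_big big1// => j _; rewrite -scaler_suml.
    have /matrixP/(_ 0 j) := xA; rewrite !mxE => xA0.
    rewrite (eq_bigr (fun i => x 0 i * A i j)) ?xA0 ?scale0r// => k _.
    by rewrite mxE.
  move=> k _; rewrite scalerBr scaler_sumr; congr (_ - _).
  by apply: eq_bigr => j _; rewrite scalerA.
by apply: subspace_sum => // k _; exact: subspaceZ.
Qed.

Lemma indep_mod_cons n (b : 'I_n -> W) w : indep_mod b -> ~ span_mod b w ->
  indep_mod (fun i : 'I_n.+1 => oapp b w (unlift ord0 i)).
Proof.
move=> ib nw c; rewrite big_ord_recl/= unlift_none/= => Sc.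
have c0 : c ord0 = 0.
  apply: contra_notP nw => /eqP c0.
  exists (fun i => - (c ord0)^-1 * c (lift ord0 i)).
  have := subspaceZ (c ord0)^-1 hS Sc.
  rewrite scalerDr scalerA mulVf// scale1r scaler_sumr.
  congr S; congr (_ + _); rewrite -sumrN; apply: eq_bigr => i _.
  by rewrite liftK/= scalerA mulNr scaleNr opprK.
move=> i; case: (unliftP ord0 i) => [j|] ->//.
apply: (ib (fun j => c (lift ord0 j))); move: Sc.
rewrite c0 scale0r add0r; congr S; apply: eq_bigr => k _.
by rewrite liftK.
Qed.

(** The bound [N] provides an independent family in [H] of maximal length; maximality puts [H],
    hence [W], in its span. *)
Lemma ex_basis_mod (H : set W) N : lspan H = [set: W] ->
  (forall n (b : 'I_n -> W), (forall i, H (b i)) -> indep_mod b ->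
    (n <= N)%N) ->
  exists n (b : 'I_n -> W), [/\ (n <= N)%N, forall i, H (b i), indep_mod b
    & forall w, span_mod b w].
Proof.
move=> spH hN; pose P n := `[< exists b : 'I_n -> W,
  (forall i, H (b i)) /\ indep_mod b >].
have P0 : exists n, P n.
  by exists 0%N; apply/asboolP; exists (fun=> 0); split=> [[]|? _ []].
have PN n : P n -> (n <= N)%N by move=> /asboolP[b [Hb ib]]; exact: hN ib.
case: (ex_maxnP P0 PN) => n /asboolP[b [Hb ib]] nmax.
exists n, b; split=> //; first exact: hN ib.
suff sH : H `<=` span_mod b.
  move=> w; apply: (lspan_sub (span_mod_subspace b) sH).
  by rewrite spH.
move=> w Hw; apply: contrapT => nw.
suff /nmax : P n.+1 by rewrite ltnn.
apply/asboolP; exists (fun i => oapp b w (unlift ord0 i)).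
split; last exact: indep_mod_cons.
by move=> i; case: (unlift ord0 i) => /=.
Qed.

Lemma has_quotient_dimP n : has_quotient_dim S n <->
  exists b : 'I_n -> W, indep_mod b /\ forall w, span_mod b w.
Proof.
split=> -[b hb]; exists b; last first.
  case: hb => ib sb w; have [c Sc] := sb w.
  exists [ffun i => c i]; split.
    by move: Sc; under [in X in _ -> X]eq_bigr do rewrite ffunE.
  move=> d Sd; apply/ffunP => i; rewrite ffunE; apply/eqP; rewrite -subr_eq0.
  apply/eqP; apply: (ib (fun i => c i - d i)).
  have := subspaceB hS Sd Sc; congr S.
  rewrite opprB addrC addrA subrK -sumrB; apply: eq_bigr => j _.
  by rewrite scalerBl.
split; last first.
  by move=> w; have [c [Sc _]] := hb w; exists c.
move=> c Sc i; have [d [_ ud]] := hb 0.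
have d0 : d = [ffun=> 0].
  apply: ud; rewrite sub0r; apply: subspaceN => //.
  by apply: subspace_sum => // j _; rewrite ffunE scale0r; exact: subspace0.
suff : d = [ffun i => c i] by rewrite d0 => /ffunP/(_ i); rewrite !ffunE.
apply: ud; rewrite sub0r; apply: subspaceN => //.
by under eq_bigr do rewrite ffunE.
Qed.

Lemma quotient_dimP : finite_quotient S -> has_quotient_dim S (quotient_dim S).
Proof. exact: (@xgetPex _ 0%N [set n | has_quotient_dim S n]). Qed.

(** Used with [H] the homogeneous vectors, to obtain homogeneous generators modulo C_1. *)
Lemma ex_basis_mod_in (H : set W) : finite_quotient S -> lspan H = [set: W] ->
  exists n (b : 'I_n -> W), [/\ (n <= quotient_dim S)%N, forall i, H (b i)
    & forall w, span_mod b w].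
Proof.
move=> /quotient_dimP/has_quotient_dimP[b [ib sb]] spH.
have [n [b' [nN Hb' _ sb']]] : exists n (b' : 'I_n -> W),
    [/\ (n <= quotient_dim S)%N, forall i, H (b' i), indep_mod b'
      & forall w, span_mod b' w].
  apply: ex_basis_mod => // n b' _ ib'; exact: indep_mod_leq ib' _.
by exists n, b'.
Qed.

(** Finiteness belongs to the conclusion because [quotient_dim] defaults to 0 on infinite quotients,
    where the bound alone would be vacuous. *)
Lemma quotient_dim_leq N :
  (forall n (b : 'I_n -> W), indep_mod b -> (n <= N)%N) ->
  finite_quotient S /\ (quotient_dim S <= N)%N.
Proof.
move=> hN.
have fS : finite_quotient S.
  have [|//|n [b [_ _ ib sb]]] := @ex_basis_mod setT N.
    by apply/seteqP; split=> // w _; exact: sub_lspan.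
  by move=> n b _; exact: hN.
  by exists n; apply/has_quotient_dimP; exists b.
split=> //; have /has_quotient_dimP[b [ib _]] := quotient_dimP fS.
exact: hN ib.
Qed.

End QuotientDimension.

(** * Gradings *)

Section Grading.
Context {R : realType} {W : lmodType R[i]} {I : choiceType} {S : I -> set W}.
Hypothesis dS : direct_sum S.

Definition component i w : W := projT1 (cid (dS.2 w)) i.

Lemma componentP w : [/\ forall i, S i (component i w),
  finite_set [set i | component i w != 0]
  & w = \sum_(i \in [set: I]) component i w].
Proof. by rewrite /component; case: cid => f []. Qed.

Lemma component_uniq w f : (forall i, S i (f i)) ->
  finite_set [set i | f i != 0] -> w = \sum_(i \in [set: I]) f i ->
  forall i, component i w = f i.
Proof.
move=> Sf ff wf i; rewrite /component; case: cid => g [_ /= ug].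
by rewrite (ug f).
Qed.

Lemma component_linear i : linear (component i).
Proof.
move=> a u v; have [Su fu uE] := componentP u; have [Sv fv vE] := componentP v.
set A := [set i | component i u != 0] `|` [set i | component i v != 0].
have fA : finite_set A by rewrite finite_setU.
have widen (f : I -> W) :
    (forall i, component i u = 0 -> component i v = 0 -> f i = 0) ->
    \sum_(i \in [set: I]) f i = \sum_(i <- finmap.enum_fset (fset_set A)) f i.
  move=> f0; transitivity (\sum_(i \in A) f i); last by rewrite fsbig_finite.
  apply/esym/fsbig_widen => // j [_ /= nAj].
  by apply: f0; apply: contra_notP nAj => /eqP ?; [left|right].
apply: (component_uniq (f := fun i => a *: component i u + component i v)).
- by move=> j; apply: (dS.1 j).2.
- apply: sub_finite_set fA => j /=; apply: contra_neqP => /not_orP[].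
  by do 2![move=> /negP; rewrite negbK => /eqP ->]; rewrite scaler0 addr0.
rewrite widen; last by move=> j -> ->; rewrite scaler0 addr0.
rewrite {1}uE {1}vE !widen// big_split/= scaler_sumr//.
Qed.

Lemma component_id i w : S i w -> component i w = w.
Proof.
move=> Siw; rewrite (component_uniq (f := fun j => if j == i then w else 0)).
- by rewrite eqxx.
- by move=> j; case: eqVneq => [->//|_]; exact: subspace0 (dS.1 j).
- apply: (sub_finite_set _ (finite_set1 i)) => j /=.
  by case: (j =P i) => // _; rewrite eqxx.
rewrite -(fsbig_widen [set i])// ?fsbig_set1 ?eqxx//.
by move=> j [_ /= /eqP/negbTE ->].
Qed.

Lemma component_neq i j w : S i w -> j != i -> component j w = 0.
Proof.
move=> Siw /negbTE ji.
rewrite (component_uniq (f := fun j => if j == i then w else 0)).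
- by rewrite ji.
- by move=> k; case: eqVneq => [->//|_]; exact: subspace0 (dS.1 k).
- apply: (sub_finite_set _ (finite_set1 i)) => k /=.
  by case: (k =P i) => // _; rewrite eqxx.
rewrite -(fsbig_widen [set i])// ?fsbig_set1 ?eqxx//.
by move=> k [_ /= /eqP/negbTE ->].
Qed.

Lemma component_mem i w : (forall j, j != i -> component j w = 0) -> S i w.
Proof.
move=> w0; have [Sw _ ->] := componentP w.
rewrite -(fsbig_widen [set i])// ?fsbig_set1// => j [_ /= /eqP]; exact: w0.
Qed.

Lemma homogeneous_span : lspan (\bigcup_i S i) = [set: W].
Proof.
apply/seteqP; split=> // w _; have [Sw fw ->] := componentP w.
rewrite -(fsbig_widen [set i | component i w != 0])//; last first.
  by move=> i [_ /= /negP]; rewrite negbK => /eqP.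
rewrite fsbig_finite//; apply: subspace_sum => // i _.
by apply: sub_lspan; exists i.
Qed.

(** The projection to degree [i] fixes [G i] and kills every other [G j]. *)
Lemma graded_span (G : I -> set W) : (forall i, G i `<=` S i) ->
  lspan (\bigcup_i G i) = [set: W] -> forall i, S i `<=` lspan (G i).
Proof.
move=> GS spG i w Siw; rewrite -(component_id Siw).
have spw : lspan (\bigcup_i G i) w by rewrite spG.
apply: (linear_lspan (component_linear i) (lspan_subspace (G i)) _ spw).
move=> {spw}w' [j _ Gjw']; have [<-|ji] := eqVneq j i.
  by rewrite (component_id (GS _ _ Gjw')); exact: sub_lspan.
by rewrite (component_neq (GS _ _ Gjw')) 1?eq_sym//; exact: subspace0.
Qed.

End Grading.

(** * Eigenvectors of operators of finite order *)

Section ExpIPi.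
Context {R : realType}.
Implicit Types s t : R.

Lemma exp_ipi0 : exp_ipi (0 : R) = 1.
Proof. by rewrite /exp_ipi mulr0 cos0 sin0. Qed.

Lemma exp_ipiD s t : exp_ipi (s + t) = exp_ipi s * exp_ipi t.
Proof.
by rewrite /exp_ipi mulrDr cosD sinD; congr Complex; rewrite [RHS]addrC mulrC.
Qed.

Lemma exp_ipi_neq0 t : exp_ipi t != 0.
Proof.
apply: contraTneq (@oner_neq0 R[i]) => t0.
by rewrite -exp_ipi0 -(subrr t) exp_ipiD t0 mul0r eqxx.
Qed.

Lemma exp_ipiX t n : exp_ipi t ^+ n = exp_ipi (t * n%:R).
Proof.
elim: n => [|n IH]; first by rewrite mulr0 exp_ipi0.
by rewrite exprS IH -exp_ipiD -{1}(mulr1 t) -mulrDr -natr1 addrC.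
Qed.

Lemma exp_ipi_2nat n : exp_ipi (2 * n%:R : R) = 1.
Proof.
rewrite -exp_ipiX (_ : exp_ipi 2 = 1) ?expr1n//.
by rewrite /exp_ipi mulr_natr cos2pi sin2pi.
Qed.

Lemma exp_ipi_2int (m : int) : exp_ipi (2 * m%:~R : R) = 1.
Proof.
case: (intP m) => [|n|n]; first by rewrite mulr0 exp_ipi0.
  exact: exp_ipi_2nat.
apply: (mulIf (exp_ipi_neq0 (2 * n.+1%:R))).
by rewrite -exp_ipiD -mulrDr mulrNz addNr mulr0 exp_ipi0 mul1r exp_ipi_2nat.
Qed.

Lemma exp_ipi_eq1 t : exp_ipi (2 * t) = 1 -> exists m : int, t = m%:~R.
Proof.
move=> t1; exists (Num.floor t); apply/eqP; rewrite -subr_eq0.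
(* For the fractional part [s], [exp_ipi s] is 1 or -1, so sin(pi s) = 0, whereas the sine is
   positive when 0 < s < 1. *)
set s := t - _.
have : exp_ipi s ^+ 2 = 1.
  rewrite exp_ipiX mulrC mulrBr exp_ipiD t1 mul1r -mulrN -mulrNz.
  exact: exp_ipi_2int.
move=> /eqP; rewrite sqrf_eq1 => s1.
have sin0 : sin (pi * s) = 0 by case/orP: s1 => /eqP[] // _ ->; rewrite ?oppr0.
have s0 : 0 <= s by rewrite subr_ge0 floor_le.
have s_lt1 : s < 1 by rewrite ltrBlDl -intrD1 floorD1_gt.
rewrite eq_le s0 andbT leNgt; apply/negP => s_gt0.
have : 0 < sin (pi * s); last by rewrite sin0 ltxx.
apply: sin_gt0_pi; rewrite mulr_gt0 ?pi_gt0//=.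
by rewrite -[ltRHS]mulr1 ltr_pM2l ?pi_gt0.
Qed.

End ExpIPi.

Section EigenDecomposition.
Context {R : realType} {V : lmodType R[i]} {g : V -> V} {T : nat}.
Hypotheses (lg : linear g) (gT : iter T g =1 id) (T_gt0 : (0 < T)%N).

(** [f r] is the discrete Fourier component T^-1 sum_s e^(2 pi i r s/T) g^s v. The invariant
    subspace [X] serves to keep the weight of [v] and its eigenvalue under a commuting
    automorphism. *)
Lemma eigen_decomposition (X : set V) v : is_subspace X ->
  (forall u, X u -> X (g u)) -> X v ->
  exists f : 'I_T -> V, [/\ forall r, X (f r),
    forall r, g (f r) = exp_ipi (- (2%:R * r%:R / T%:R)) *: f r
    & v = \sum_r f r].
Proof.
move=> hX gX Xv; have T0 : T%:R != 0 :> R by rewrite pnatr_eq0 -lt0n.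
pose F (r s : nat) := exp_ipi (2 * r%:R / T%:R * s%:R : R) *: iter s g v.
exists (fun r => T%:R^-1 *: \sum_(s < T) F r s); split=> [r|r|].
- apply: subspaceZ => //; apply: subspace_sum => // s _; apply: subspaceZ => //.
  by elim: (val s) => //= n; exact: gX.
- rewrite (linfunZ lg) (linfun_sum lg) scalerA mulrC -scalerA; congr (_ *: _).
  transitivity (\sum_(s < T) exp_ipi (- (2 * r%:R / T%:R)) *: F r s.+1).
    apply: eq_bigr => s _; rewrite (linfunZ lg) /F scalerA -exp_ipiD/=.
    by congr (exp_ipi _ *: _); rewrite -natr1; ring.
  rewrite -scaler_sumr; congr (_ *: _).
  (* The shifted sum equals the original one, as the terms at s = T and s = 0 agree. *)
  have <- : \sum_(s < T.+1) F r s - F r 0 = \sum_(s < T) F r s.+1.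
    by rewrite big_ord_recl/= addrC addKr.
  rewrite big_ord_recr/= /F gT mulr0 exp_ipi0/= divfK// exp_ipi_2nat.
  by rewrite addrK.
rewrite -scaler_sumr exchange_big/=.
under eq_bigr do rewrite -scaler_suml.
rewrite (bigD1 (Ordinal T_gt0))//= [X in _ *: (_ + X)]big1 ?addr0.
  under eq_bigr do rewrite /= mulr0 exp_ipi0.
  rewrite sumr_const card_ord scalerA mulVf ?scale1r//.
  by rewrite pnatr_eq0 -lt0n.
(* For 0 < s < T, [z] is a T-th root of unity other than 1, so its powers sum to zero. *)
move=> s s0; set z := exp_ipi (2 * s%:R / T%:R : R).
rewrite (eq_bigr (fun r : 'I_T => z ^+ r)); last first.
  by move=> r _; rewrite exp_ipiX; congr exp_ipi; ring.
suff -> : \sum_(r < T) z ^+ r = 0 by rewrite scale0r.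
have : z ^+ T - 1 = 0 by rewrite exp_ipiX divfK// exp_ipi_2nat subrr.
rewrite subrX1 => /eqP; rewrite mulf_eq0 => /orP[|/eqP//].
rewrite subr_eq0 => /eqP; rewrite /z -mulrA => /exp_ipi_eq1[m sTm].
have : 0 < s%:R / T%:R :> R by rewrite divr_gt0 ?ltr0n// lt0n.
have : s%:R / T%:R < 1 :> R by rewrite ltr_pdivrMr ?ltr0n// mul1r ltr_nat.
by rewrite sTm ltrz1 ltr0z => m1 m0; exfalso; lia.
Qed.

End EigenDecomposition.

(** * Vertex operator algebras *)

Lemma gbinom0 {R : realType} (t : R) : gbinom t 0 = 1.
Proof. by rewrite /gbinom big_ord0 fact0 divr1. Qed.

Lemma gbinom1 {R : realType} (t : R) : gbinom t 1 = t.
Proof. by rewrite /gbinom big_ord1 subr0 factS fact0 muln1 divr1. Qed.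

Lemma gbinom_nat {R : realType} (n k : nat) :
  (n < k)%N -> gbinom (n%:R : R) k = 0.
Proof.
by move=> nk; rewrite /gbinom (bigD1 (Ordinal nk))//= subrr !mul0r.
Qed.

Definition delta_coef {R : realType} (sx sy sz : bool) (beta : R) (k : nat)
    : R[i] :=
  (gbinom beta k)%:C%C * sign_pow sx (- beta)
    * sign_pow sy (beta - k%:R) * sign_pow sz (k%:R : R).

Lemma delta_coef_fff {R : realType} (beta : R) k :
  delta_coef false false false beta k = (gbinom beta k)%:C%C.
Proof. by rewrite /delta_coef /sign_pow !mulr1. Qed.

(** [F] lives in exponent 0 of its first variable, so [a] selects a single [beta] in the sum over Z.
    The expansion stops at [J] because either the binomial or [F] vanishes. *)
Lemma delta_mulE {R : realType} {W : lmodType R[i]} {sx sy sz : bool}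
    (alpha beta : R) (n : int) (J : nat) (F : R[i] -> R[i] -> R[i] -> W)
    (a b c : R[i]) :
  beta = n%:~R + alpha -> a = - 1 - beta%:C%C ->
  (forall x y z, x != 0 -> F x y z = 0) ->
  (forall j, (J <= j)%N ->
    gbinom beta j = 0 \/ F 0 (b - beta%:C%C + j%:R) (c - j%:R) = 0) ->
  delta_mul sx sy sz alpha F a b c =
  \sum_(j < J) delta_coef sx sy sz beta j
    *: F 0 (b - beta%:C%C + j%:R) (c - j%:R).
Proof.
move=> betaE aE F0 FJ; rewrite /delta_mul.
set G := fun p => _; rewrite (_ : \sum_(p \in _) _ = \sum_(p \in setT) G p)//.
have aE0 (m : int) : a + 1 + (m%:~R + alpha)%:C%C = (m - n)%:~R.
  rewrite aE betaE addrAC !rmorphD/= !rmorph_int mulrNz; ring.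
transitivity (\sum_(p \in [set (n, j) | j in `I_J]) G p); last first.
  rewrite fsbig_image; last by move=> i j _ _ [].
  rewrite -fsbig_ord; apply: eq_bigr => j _.
  by rewrite /G/= aE0 subrr mulr0z -betaE.
apply/esym/fsbig_widen => // -[m j] [_ /= nj]; rewrite /G/= aE0.
have [mn|mn] := eqVneq m n; last first.
  by rewrite F0 ?scaler0// intr_eq0 subr_eq0.
rewrite mn subrr mulr0z -betaE; have [|->|->] := FJ j.
- by rewrite leqNgt; apply/negP => jJ; apply: nj; exists j; rewrite ?mn.
- by rewrite rmorph0 !mul0r scale0r.
- by rewrite scaler0.
Qed.

Lemma const_coef0 {R : realType} {W : lmodType R[i]} (w : W) :
  const_coef 0 w = w.
Proof. by rewrite /const_coef eqxx. Qed.

Lemma const_coef_neq {R : realType} {W : lmodType R[i]} (e : R[i]) (w : W) :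
  e != 0 -> const_coef e w = 0.
Proof. by rewrite /const_coef => /negbTE ->. Qed.

Section VertexAlgebra.
Context {R : realType} {V : voa R}.

Definition Lm1 (v : V) : V := vir (@vmode R V) (conformal V) (-1) v.
Definition L0 (v : V) : V := vir (@vmode R V) (conformal V) 0 v.

Lemma L0_linear : linear L0. Proof. exact: voa_linear_r. Qed.

(** For the converse, the projection [c] to weight j satisfies c L(0) = j c, so an eigenvector for n
    has (n - j) c(v) = 0. *)
Lemma vwtP n v : vwt n v <-> L0 v = n%:~R *: v.
Proof.
split=> [|vn]; first exact: voa_L0.
apply: (component_mem (dS := voa_graded V)) => j jn.
pose c := component (voa_graded V) j.
have lc : linear c by exact: component_linear.
have cL0 w : c (L0 w) = j%:~R *: c w.
  have : [set: V] w by []. rewrite -(homogeneous_span (voa_graded V)).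
  apply: (lspan_sub (S := [set w | c (L0 w) = j%:~R *: c w]))
    => [|{}w [i _ wi]].
    split=> /= [|a x y hx hy].
      by rewrite (linfun0 L0_linear) (linfun0 lc) scaler0.
    by rewrite L0_linear !lc hx hy scalerDr !scalerA mulrC.
  rewrite /= /L0 (voa_L0 wi) (linfunZ lc).
  have [->//|ji] := eqVneq j i; rewrite /c (component_neq (voa_graded V) wi)//.
  by rewrite !scaler0.
move: (cL0 v); rewrite vn (linfunZ lc) => /eqP.
rewrite -subr_eq0 -scalerBl -mulrzBr scaler_eq0 intr_eq0 subr_eq0 eq_sym.
by rewrite (negbTE jn) => /eqP.
Qed.

Lemma vwt_Lm1 n v : vwt n v -> vwt (n + 1) (Lm1 v).
Proof.
move=> /vwtP vn; apply/vwtP.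
have := @voa_virasoro _ V 0 (-1) v; rewrite /= -/(Lm1 _) -!/(L0 _) -/(Lm1 _).
rewrite sub0r opprK addr0 scale1r => /eqP; rewrite subr_eq => /eqP ->.
rewrite vn /Lm1 /vir (linfunZ (voa_linear_r _ _)).
by rewrite rmorphD/= scalerDl scale1r addrC.
Qed.

Lemma vacuum_mode (v : V) : vmode v (-2) (vacuum V) = Lm1 v.
Proof.
rewrite -(voa_creation (Lm1 v)).1 voa_Lm1 opprK scale1r; congr (vmode v _ _).
by ring.
Qed.

Lemma vwt_aut (g : V -> V) n v : voa_automorphism g -> vwt n v -> vwt n (g v).
Proof.
move=> [lg _ gY _ gw] /vwtP vn; apply/vwtP.
by rewrite -(linfunZ lg) -vn /L0 /vir gY gw.
Qed.

Lemma eigen_Lm1 (g : V -> V) T r v : voa_automorphism g -> eigen g T r v ->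
  eigen g T r (Lm1 v).
Proof.
move=> [lg _ gY _ gw] gv; rewrite /eigen/= /Lm1 /vir gY gw gv.
by rewrite (linfunZ (voa_linear_r _ _)).
Qed.

Lemma eigen_conformal (g : V -> V) T : voa_automorphism g ->
  eigen g T 0 (conformal V).
Proof.
by move=> [_ _ _ _ gw]; rewrite /eigen/= mulr0 mul0r oppr0 exp_ipi0 scale1r.
Qed.

Lemma vwt_subspace n : is_subspace (@vwt R V n).
Proof. exact: (voa_graded V).1. Qed.

Lemma eigen_subspace (g : V -> V) T r : linear g -> is_subspace (eigen g T r).
Proof.
move=> lg; split=> [|a u v gu gv]; rewrite /eigen/=.
  by rewrite (linfun0 lg) scaler0.
by rewrite lg gu gv scalerDr !scalerA mulrC.
Qed.

End VertexAlgebra.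

(** * Twisted modules *)

Section TwistedModule.
Context {R : realType} {V : voa R} {g : V -> V} {T : nat}.
Hypotheses (hg : voa_automorphism g) (T_gt0 : (0 < T)%N).
Variable W : twisted_module g T.
Implicit Types (v : V) (w : W).

Lemma wmode0 (n : R[i]) v : wmode v n (0 : W) = 0.
Proof. exact: linfun0 (tw_linear_r v n). Qed.

Lemma wmode0l (n : R[i]) w : wmode (0 : V) n w = 0.
Proof. exact: linfun0 (tw_linear_l n w). Qed.

Lemma wmode_eventually0 r v w (m : int) : (r < T)%N -> eigen g T r v ->
  exists J : nat, forall j : nat, (J <= j)%N ->
    wmode v (m%:~R - r%:R / T%:R + j%:R) w = 0.
Proof.
move=> rT vr; have [N hN] := tw_truncation w rT vr.
exists `|- m - N|%N => j Jj; apply: contrapT => /eqP.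
have := hN (r%:R / T%:R - m%:~R - j%:R - 1); rewrite /coef.
rewrite (_ : - _ - 1 = m%:~R - r%:R / T%:R + j%:R); last by ring.
move=> h /h[k [Nk /eqP]].
rewrite (_ : _ - _ - _ - 1 = r%:R / T%:R + (- m - j%:Z - 1)%:~R); last first.
  by rewrite !rmorphD !rmorphN/=; ring.
by rewrite (inj_eq (addrI _)) eqr_int => /eqP; lia.
Qed.

(** The L(-1)-derivative property of W comes from the Jacobi identity with the vacuum as second
    vector, since Y(v, x0)1 = v + x0 L(-1)v + ... *)
Lemma wmode_Lm1 r v w (m : int) : (r < T)%N -> eigen g T r v ->
  let n : R[i] := m%:~R - r%:R / T%:R in
  wmode (Lm1 v) n w = - n *: wmode v (n - 1) w.
Proof.
move=> rT vr n; pose a : R := (m + 1)%:~R - r%:R / T%:R.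
have aE : a%:C%C = n + 1.
  rewrite /a rmorphB/= rmorph_int fmorph_div/= !rmorph_nat rmorphD/= /n; ring.
(* The first sum keeps only v_(n-1) w and the second is zero. The third keeps j = 0, from v_(-2)1 =
   L(-1)v, and j = 1, from v_(-1)1 = v. *)
have := tw_jacobi (vacuum V) w 1 (- 1 - a%:C%C) 0 rT vr.
rewrite (delta_mulE (beta := -2) (n := -2) (J := 1)) ?addr0//; first last.
- case=> // j _; right; rewrite const_coef0 /coef tw_vacuum.
  case: eqP => [/eqP|_]; last by rewrite wmode0.
  by rewrite sub0r opprK subr_eq addrC subrr pnatr_eq0.
- by move=> x y z x0; rewrite const_coef_neq.
- by rewrite rmorphN rmorph_nat; ring.
rewrite (delta_mulE (beta := -2) (n := -2) (J := 0)) ?addr0//; first last.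
- move=> j _; right; rewrite const_coef0 /coef tw_vacuum.
  case: eqP => // /eqP; rewrite rmorphN rmorph_nat sub0r opprK.
  by rewrite subr_eq addNr oppr_eq0 -natrD pnatr_eq0.
- by move=> x y z x0; rewrite const_coef_neq.
- by rewrite rmorphN rmorph_nat; ring.
rewrite (delta_mulE (beta := a) (n := m + 1) (J := 2))//; first last.
- case=> [|[|j]]// _; right; rewrite const_coef0 /coef.
  rewrite (_ : - (1 - _) - 1 = j%:R) ?(voa_creation v).2 ?wmode0l//.
  by rewrite -addn2 natrD; ring.
- by move=> x y z x0; rewrite const_coef_neq.
rewrite big_ord0 subr0 big_ord1 !big_ord_recl big_ord0 /= addr0.
rewrite !delta_coef_fff gbinom0 gbinom1 /delta_coef /sign_pow gbinom0.
rewrite !const_coef0 /coef !subr0 !addr0 tw_vacuum.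
rewrite oppr0 sub0r eqxx exp_ipi0 !mulr1 !scale1r aE (_ : bump 0 0 = 1%N)//.
rewrite (_ : vmode v (-1 - 1) _ = Lm1 v); last first.
  by rewrite -vacuum_mode; congr (vmode v _ _); ring.
rewrite (_ : vmode v _ (vacuum V) = v); last first.
  by rewrite -[RHS](voa_creation v).1; congr (vmode v _ _); ring.
rewrite (_ : - (-1 - _ - _) - 1 = n - 1); last first.
  by rewrite rmorphN rmorph_nat; ring.
rewrite (_ : - (0 - _) - 1 = n); last by ring.
rewrite (_ : - (0 - _ + _) - 1 = n - 1); last by ring.
move=> vE; apply: (addIr ((n + 1) *: wmode v (n - 1) w)).
by rewrite -vE -scalerDl (_ : - n + (n + 1) = 1) ?scale1r//; ring.
Qed.

(** The Jacobi identity for omega gives [L(0), v_a] = (L(-1)v)_(a+1) + (L(0)v)_a; both terms are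
    multiples of v_a. *)
Lemma wmode_L0 n r v w (m : int) : (r < T)%N -> eigen g T r v -> vwt n v ->
  let a : R[i] := m%:~R - r%:R / T%:R in
  wvir 0 (wmode v a w) = wmode v a (wvir 0 w) + (n%:~R - a - 1) *: wmode v a w.
Proof.
move=> rT vr vn a.
have := tw_jacobi v w (-1) (-2) (- a - 1) T_gt0 (eigen_conformal T hg).
rewrite (delta_mulE (beta := 0) (n := 0) (J := 1))
  ?addr0 ?rmorph0 ?subr0//; first last.
- by case=> // j _; left; exact: (gbinom_nat (n := 0)).
- by move=> x y z x0; rewrite const_coef_neq.
rewrite (delta_mulE (beta := 0) (n := 0) (J := 1))
  ?addr0 ?rmorph0 ?subr0//; first last.
- by case=> // j _; left; exact: (gbinom_nat (n := 0)).
- by move=> x y z x0; rewrite const_coef_neq.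
rewrite (delta_mulE (beta := 1) (n := 1) (J := 2))//; first last.
- by case=> [|[|j]]// _; left; exact: (gbinom_nat (n := 1)).
- by move=> x y z x0; rewrite const_coef_neq.
- by rewrite rmorph1; ring.
- by rewrite mul0r oppr0 addr0.
rewrite !big_ord_recl !big_ord0 /= !addr0.
rewrite !delta_coef_fff !gbinom0 !gbinom1 /delta_coef /sign_pow !gbinom0.
rewrite !const_coef0 /coef !subr0 ?oppr0 ?exp_ipi0 ?rmorph1 !mulr1 !scale1r.
rewrite (_ : - (-2) - 1 = 0%:~R + 1 :> R[i]); last by rewrite mulr0z; ring.
rewrite (_ : - (-1) - 1 = (-1)%:~R + 1 :> R[i]); last by rewrite mulrNz; ring.
rewrite (_ : - (-1 - 1) - 1 = 0%:~R + 1 :> R[i]); last by rewrite mulr0z; ring.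
rewrite -/(vir (@vmode R V) _ _) -/(vir (@vmode R V) _ _ _) -/(Lm1 v) -/(L0 v).
rewrite (proj1 (vwtP n v) vn) (_ : - (- a - 1) - 1 = a); last by ring.
rewrite (_ : - (- a - 1 - 1 + 1) - 1 = a); last by ring.
rewrite (_ : - (- a - 1 - 1) - 1 = (m + 1)%:~R - r%:R / T%:R); last first.
  by rewrite rmorphD/= /a; ring.
rewrite (wmode_Lm1 w (m + 1) rT vr).
rewrite (_ : _ - _ - 1 = a); last by rewrite rmorphD/= /a; ring.
rewrite (linfunZ (tw_linear_l a w)) -scalerDl => /eqP; rewrite subr_eq => /eqP.
rewrite /wvir /vir => ->; rewrite addrC; congr (_ + _ *: _).
by rewrite rmorphD/= /a; ring.
Qed.

(** v_a intertwines L(0) minus the old weight with L(0) minus the new one, so the same exponent [k]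
    works. *)
Lemma wmode_weight n r v w (m : int) lambda : (r < T)%N -> eigen g T r v ->
  vwt n v -> gen_weight W lambda w ->
  let a : R[i] := m%:~R - r%:R / T%:R in
  gen_weight W (lambda + n%:~R - a - 1) (wmode v a w).
Proof.
move=> rT vr vn [k wk] a; exists k.
rewrite -(wmode0 a v) -wk; elim: k {wk} => //= k ->.
rewrite (wmode_L0 _ _ rT vr vn) (linfunB (tw_linear_r v a)).
rewrite (linfunZ (tw_linear_r v a)) -addrA; congr (_ + _).
by rewrite -scalerBl -scaleNr /a; congr (_ *: _); ring.
Qed.

Lemma wvir_Lm1_weight w lambda : gen_weight W lambda w ->
  gen_weight W (lambda + 1) (wvir (-1) w).
Proof.
have om := eigen_conformal T hg.
move=> /(wmode_weight 0 T_gt0 om (voa_conformal_wt V))/=.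
rewrite /wvir /vir; congr (gen_weight _ _ (wmode _ _ _)).
  by rewrite mulr0z mul0r; ring.
by rewrite mulr0z mul0r mulrNz; ring.
Qed.

Definition C1_generator (w' : W) : Prop :=
  exists r n v w, [/\ (r < T)%N, 0 <= n, (0 < n) || (0 < r)%N, vwt n v
    & eigen g T r v /\ w' = wmode v (- 1 - r%:R / T%:R) w].

Lemma C1E : C1 W = lspan C1_generator.
Proof.
congr lspan; apply/seteqP; split=> [w' [|]|w'].
- move=> [n [v [w [n_gt0 vn v0 ->]]]]; exists 0%N, n, v, w.
  by rewrite n_gt0 ltW// mul0r subr0.
- move=> [r [n [v [w [/andP[r0 rT] n0 vn vr ->]]]]]; exists r, n, v, w.
  by rewrite r0 orbT.
move=> [r [n [v [w [rT n0 nr vn [vr ->]]]]]].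
case: (posnP r) => [r0|r_gt0]; last by right; exists r, n, v, w; rewrite r_gt0.
left; exists n, v, w; move: nr vr; rewrite r0 orbF mul0r subr0 => *.
by split.
Qed.

Lemma C1_subspace : is_subspace (C1 W). Proof. exact: lspan_subspace. Qed.

(** Since v_(a-1) = (-a)^-1 (L(-1)v)_a for a nonzero, induction on [j] reduces lower modes to
    generators. L(-1) raises the weight, so j > 0 can replace n > 0 or r > 0. *)
Lemma C1_mode (j : nat) n r v w : (r < T)%N -> 0 <= n ->
  [|| 0 < n, (0 < r)%N | (0 < j)%N] -> vwt n v -> eigen g T r v ->
  C1 W (wmode v (- 1 - r%:R / T%:R - j%:R) w).
Proof.
elim: j n v w => [|j IH] n v w rT n0 nrj vn vr.
  rewrite orbF in nrj; rewrite subr0 C1E; apply: sub_lspan.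
  by exists r, n, v, w.
pose a : R[i] := (- 1 - j%:Z)%:~R - r%:R / T%:R.
have a_neq0 : - a != 0.
  rewrite /a rmorphB/= mulrNz opprB opprB.
  by rewrite lt0r_neq0// ltr_wpDl ?divr_ge0// addr_gt0 ?ltr01.
have := wmode_Lm1 w (- 1 - j%:Z) rT vr; rewrite -/a => aE.
have -> : wmode v (- 1 - r%:R / T%:R - j.+1%:R) w =
    (- a)^-1 *: wmode (Lm1 v) a w.
  rewrite aE scalerA mulVf// scale1r; congr wmode.
  by rewrite -natr1 /a rmorphB/= mulrNz; ring.
apply: subspaceZ C1_subspace _.
rewrite (_ : a = - 1 - r%:R / T%:R - j%:R); last first.
  by rewrite /a rmorphB/= mulrNz; ring.
apply: (IH (n + 1)) => //; last exact: eigen_Lm1.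
- lia.
- by apply/orP; left; lia.
- exact: vwt_Lm1.
Qed.

End TwistedModule.

(** * Separation of powers of x and log x *)

Section LogSeparation.
Context {R : realType} {W : lmodType R[i]}.
Implicit Types (c : R[i] -> nat -> W) (S : set W).

(* [x d/dx] acting on the coefficients of [sum c l k x^l (log x)^k] *)
Definition log_derive c (l : R[i]) (k : nat) : W :=
  l *: c l k + k.+1%:R *: c l k.+1.

Lemma iter_log_derive_linear i c1 c2 a :
  iter i log_derive (fun l k => a *: c1 l k + c2 l k) =
  fun l k => a *: iter i log_derive c1 l k + iter i log_derive c2 l k.
Proof.
elim: i => //= i ->; apply/funext => l; apply/funext => k.
rewrite /log_derive !scalerDr !scalerA addrACA; congr (_ + _ + _).
  by rewrite mulrC.
by rewrite mulrC.
Qed.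

(* Applying [x d/dx - mu] lowers the degree in log x of the coefficient of
   x^mu and keeps the degrees of the others. *)
Lemma log_separation S (Lam : seq R[i]) c :
  is_subspace S -> uniq Lam ->
  (forall l, exists K : nat, forall k, (K <= k)%N -> c l k = 0) ->
  (forall i, S (\sum_(l <- Lam) iter i log_derive c l 0)) ->
  forall l k, l \in Lam -> S (c l k).
Proof.
move=> hS uLam /choice[d cd].
(* Induction on the total of the bounds [d l] on the degrees in log x. *)
have [n] := ubnP (\sum_(l <- Lam) d l); elim: n => // n IH in c d cd *.
rewrite ltnS => dn Sc.
have [/allP d0|/allPn[mu muL dmu]] := boolP (all (fun l => d l == 0%N) Lam).
  by move=> l k /d0/eqP dl; rewrite cd ?dl//; exact: subspace0.
pose c' l k := (- mu) *: c l k + log_derive c l k.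
have c'E l k : c' l k = (l - mu) *: c l k + k.+1%:R *: c l k.+1.
  by rewrite /c' addrA -scalerDl addrC [- mu + l]addrC addrC.
pose d' l := if l == mu then (d mu).-1 else d l.
have Sc' l k : l \in Lam -> S (c' l k).
  apply: (IH _ d').
  - move=> l0 k0; rewrite c'E /d'; case: eqVneq => [->|_] dk.
      by rewrite subrr scale0r add0r cd ?scaler0//; lia.
    by rewrite !cd ?scaler0 ?addr0//; lia.
  - apply: leq_trans dn; rewrite !(big_rem mu muL)/= /d' eqxx.
    have -> : \sum_(l <- rem mu Lam) (if l == mu then (d mu).-1 else d l) =
        \sum_(l <- rem mu Lam) d l.
      rewrite !big_seq; apply: eq_bigr => l0.
      by rewrite mem_rem_uniq// inE => /andP[/negbTE ->].
    by rewrite ltn_add2r ltn_predL lt0n.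
  - move=> i; rewrite /c' iter_log_derive_linear big_split/= -scaler_sumr.
    by apply: hS.2 (Sc i) _; have := Sc i.+1; rewrite iterSr.
(* As [l - mu] is invertible, [c l k] is recovered from [c' l k] and [c l k.+1], descending from
   [k = d l]. *)
have Sneq l k : l \in Lam -> l != mu -> S (c l k).
  move=> lL lmu; have [p] := ubnP (d l - k)%N; elim: p k => // p IHp k kp.
  have [dk|kd] := leqP (d l) k; first by rewrite cd//; exact: subspace0.
  have Sk1 : S (c l k.+1) by apply: IHp; lia.
  have -> : c l k = (l - mu)^-1 *: (c' l k - k.+1%:R *: c l k.+1).
    by rewrite c'E addrK scalerA mulVf ?scale1r// subr_eq0.
  apply: subspaceZ => //; apply: subspaceB => //; first exact: Sc'.
  exact: subspaceZ.
(* At [mu], positive log powers are read off from [c']; power 0 is what the hypothesis for i = 0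
   leaves once the other exponents are removed. *)
move=> l k lL; have [->|lmu] := eqVneq l mu; last exact: Sneq.
case: k => [|k].
  apply: (subspaceDl (v := \sum_(l <- rem mu Lam) c l 0) hS).
    rewrite big_seq; apply: subspace_sum => // l0.
    by rewrite mem_rem_uniq// inE => /andP[? ?]; exact: Sneq.
  by have := Sc 0%N; rewrite (big_rem mu muL).
have -> : c mu k.+1 = (k.+1%:R)^-1 *: c' mu k.
  by rewrite c'E subrr scale0r add0r scalerA mulVf ?scale1r// pnatr_eq0.
by apply: subspaceZ => //; exact: Sc'.
Qed.

End LogSeparation.

Lemma comp_voa_automorphism {R : realType} {V : voa R} (g1 g2 : V -> V) :
  voa_automorphism g1 -> voa_automorphism g2 -> voa_automorphism (g1 \o g2).
Proof.
move=> [l1 b1 Y1 v1 o1] [l2 b2 Y2 v2 o2]; split=> /=.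
- by move=> a u v /=; rewrite l2 l1.
- exact: bij_comp.
- by move=> u n v; rewrite Y2 Y1.
- by rewrite v2.
- by rewrite o2.
Qed.

(** * Homogeneous generators adapted to C_1 and to both automorphisms *)

Section HomogeneousGenerators.
Context {R : realType} {V : voa R} {g g' : V -> V} {T T' : nat}.
Hypotheses (hg : voa_automorphism g) (T_gt0 : (0 < T)%N).
Hypotheses (hg' : voa_automorphism g') (T'_gt0 : (0 < T')%N).
Hypotheses (gT' : iter T' g' =1 id) (gg' : forall v, g (g' v) = g' (g v)).
Context {W : twisted_module g T} {d : nat}.
Context (b : 'I_d -> W) (beta : 'I_d -> R[i]).
Hypotheses (dW : direct_sum (gen_weight W)).
Hypotheses (bw : forall i, gen_weight W (beta i) (b i)).
Hypotheses (bS : forall w, span_mod (C1 W) b w).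

(** [v] is also an eigenvector of [g'], as the Jacobi identity for intertwining operators
    requires. *)
Definition homogeneous_generator (lambda : R[i]) : set W :=
  [set w | (exists i, lambda = beta i /\ w = b i) \/
    exists r r' n v lambda' w', [/\ (r < T)%N, (r' < T')%N, 0 <= n
      & (0 < n) || (0 < r)%N] /\ [/\ vwt n v, eigen g T r v, eigen g' T' r' v,
      gen_weight W lambda' w' & lambda = lambda' + n%:~R + r%:R / T%:R
        /\ w = wmode v (- 1 - r%:R / T%:R) w']].

Lemma homogeneous_generator_span lambda :
  gen_weight W lambda `<=` lspan (homogeneous_generator lambda).
Proof.
apply: (graded_span dW (G := homogeneous_generator)) => {lambda} [lambda w|].
  move=> [[i [-> ->//]]|].
  move=> [r [r' [n [v [l' [w' [[rT _ _ _] [vn vr _ w'l [-> ->]]]]]]]]].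
  have := wmode_weight hg T_gt0 (-1) rT vr vn w'l; rewrite /= mulrNz mulr1z.
  by congr gen_weight; ring.
set G := \bigcup_i _; apply/seteqP; split=> // w _.
have [c wc] := bS w.
rewrite -(subrK (\sum_i c i *: b i) w).
apply: (subspaceD (lspan_subspace G)); last first.
  apply: (subspace_sum (lspan_subspace G)) => i _.
  apply: (subspaceZ _ (lspan_subspace G)); apply: sub_lspan.
  by exists (beta i) => //; left; exists i.
move: wc; rewrite (C1E T_gt0); apply: lspan_sub => // {w c}.
move=> _ [r [n [v [w [rT n0 nr vn [vr ->]]]]]].
have [lg _ _ _ _] := hg; have [lg' _ _ _ _] := hg'.
(* [v] is split under [g'] without leaving its weight space and its [g]-eigenspace. *)
have [||f [fX fr' vE]] := eigen_decomposition lg' gT' T'_gt0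
    (X := [set u | vwt n u /\ eigen g T r u]) _ _ (conj vn vr).
- split=> [|a x y [xn xr] [yn yr]].
    split; first exact: subspace0 (vwt_subspace n).
    exact: subspace0 (eigen_subspace _ _ lg).
  split; [exact: (vwt_subspace n).2|exact: (eigen_subspace _ _ lg).2].
- move=> u [un ur]; split; first exact: vwt_aut.
  by rewrite /eigen/= gg' ur (linfunZ lg').
rewrite vE (linfun_sum (tw_linear_l _ _)); apply: subspace_sum => // r' _.
have spw : lspan (\bigcup_i gen_weight W i) w by rewrite (homogeneous_span dW).
apply: (linear_lspan (tw_linear_r _ _) (lspan_subspace G) _ spw).
move=> w' [l' _ w'l].
apply: sub_lspan; exists (l' + n%:~R + r%:R / T%:R) => //; right.
have [fn fr] := fX r'.
by exists r, r', n, (f r'), l', w'; split; split=> //; exact: fr'.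
Qed.

End HomogeneousGenerators.

(** * Intertwining operators *)

Section Intertwining.
Context {R : realType} {V : voa R} {g1 g2 : V -> V} {T1 T2 T3 : nat}.
Hypotheses (hg1 : voa_automorphism g1) (hg2 : voa_automorphism g2).
Hypotheses (hcomm : forall v : V, g1 (g2 v) = g2 (g1 v)).
Hypotheses (hT1 : has_order g1 T1) (hT2 : has_order g2 T2).
Hypotheses (hT3 : has_order (g1 \o g2) T3).
Context {W1 : twisted_module g1 T1} {W2 : twisted_module g2 T2}.
Context {U : twisted_module (g1 \o g2) T3}.
Variable Y : intertwining W1 W2 U.

Let T1_gt0 : (0 < T1)%N. Proof. by case: hT1. Qed.
Let T2_gt0 : (0 < T2)%N. Proof. by case: hT2. Qed.
Let T3_gt0 : (0 < T3)%N. Proof. by case: hT3. Qed.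
Let hg3 : voa_automorphism (g1 \o g2). Proof. exact: comp_voa_automorphism. Qed.

(** g1 g2 acts on [v] by e^(-2 pi i t) with t = r1/T1 + r2/T2. As (g1 g2)^T3 = 1 and [v] is nonzero,
    t T3 is an integer; dividing it by T3 gives [q] and [r3]. *)
Lemma eigen_comp r1 r2 (v : V) : v != 0 ->
  eigen g1 T1 r1 v -> eigen g2 T2 r2 v ->
  exists r3 q : nat, [/\ (r3 < T3)%N, eigen (g1 \o g2) T3 r3 v
    & r1%:R / T1%:R + r2%:R / T2%:R = q%:R + r3%:R / T3%:R :> R].
Proof.
move=> v0 v1 v2; set t : R := _ + _.
have [lg1 _ _ _ _] := hg1; have [lg3 _ _ _ _] := hg3.
have g3v : (g1 \o g2) v = exp_ipi (- (2 * t)) *: v.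
  rewrite /= v2 (linfunZ lg1) v1 scalerA -exp_ipiD; congr (exp_ipi _ *: _).
  by rewrite /t; ring.
have iterv n : iter n (g1 \o g2) v = exp_ipi (- (2 * t) * n%:R) *: v.
  elim: n => [|n IH]; first by rewrite mulr0 exp_ipi0 scale1r.
  rewrite iterS IH (linfunZ lg3) g3v scalerA -exp_ipiD; congr (exp_ipi _ *: _).
  by rewrite -natr1; ring.
have [m tm] : exists m : int, - (t * T3%:R) = m%:~R.
  apply: exp_ipi_eq1; have [_ /(_ v) + _] := hT3; rewrite iterv => /eqP.
  rewrite -subr_eq0 -{2}(scale1r v) -scalerBl scaler_eq0 (negbTE v0) orbF.
  rewrite subr_eq0.
  by move=> /eqP <-; congr exp_ipi; ring.
have t0 : 0 <= t by rewrite addr_ge0 ?divr_ge0.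
have [M tM] : exists M : nat, t * T3%:R = M%:R.
  exists `|m|%N; rewrite -[LHS]opprK tm -mulrNz [RHS]pmulrn; congr (_ *~ _).
  have : m%:~R <= 0 :> R by rewrite -tm oppr_le0 mulr_ge0.
  by rewrite lerz0 => m0; lia.
have T30 : T3%:R != 0 :> R by rewrite pnatr_eq0 -lt0n.
have tE : t = (M %/ T3)%:R + (M %% T3)%:R / T3%:R.
  apply: (mulIf T30); rewrite tM mulrDl divfK// -natrM -natrD.
  by rewrite -divn_eq.
exists (M %% T3)%N, (M %/ T3)%N; split=> //; first exact: ltn_pmod.
rewrite /eigen/= -[g1 (g2 v)]/((g1 \o g2) v) g3v tE; congr (_ *: _).
rewrite (_ : - (2 * _) =
    - (2 * (M %% T3)%:R / T3%:R) + 2 * (- (M %/ T3)%:Z)%:~R).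
  by rewrite exp_ipiD exp_ipi_2int mulr1.
by rewrite mulrNz; ring.
Qed.

(** The mode index becomes -1 - r3/T3 - (q + j), so [C1_mode] applies. If r3 = q = 0 then r1 = r2 =
    0, which leaves n > 0. *)
Lemma C1_twist (j : nat) n r1 r2 v (u : U) : 0 <= n ->
  [|| 0 < n, (0 < r1)%N | (0 < r2)%N] -> vwt n v ->
  eigen g1 T1 r1 v -> eigen g2 T2 r2 v ->
  C1 U (wmode v (- 1 - (r1%:R / T1%:R + r2%:R / T2%:R) - j%:R) u).
Proof.
move=> n0 nr vn v1 v2; have [->|v0] := eqVneq v 0.
  by rewrite wmode0l; exact: subspace0 (C1_subspace U).
have [r3 [q [r3T v3 tE]]] := eigen_comp v0 v1 v2.
have tEC : r1%:R / T1%:R + r2%:R / T2%:R = q%:R + r3%:R / T3%:R :> R[i].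
  have /(congr1 (real_complex R)) := tE.
  by rewrite !rmorphD/= !fmorph_div/= !rmorph_nat.
rewrite tEC (_ : _ - _ - _ = - 1 - r3%:R / T3%:R - (q + j)%:R); last first.
  by rewrite natrD; ring.
apply: (C1_mode hg3 T3_gt0 (n := n) _ r3T) => //.
case: (posnP r3) => [r30|_]; last by rewrite orbT.
case: (posnP q) => [q0|q_gt0]; last by rewrite addn_gt0 q_gt0 !orbT.
move: tE nr; rewrite r30 q0 mul0r addr0 => /eqP.
rewrite paddr_eq0 ?divr_ge0// !mulf_eq0 !invr_eq0 !pnatr_eq0.
rewrite !(gtn_eqF T1_gt0) !(gtn_eqF T2_gt0) !orbF => /andP[/eqP -> /eqP ->].
by rewrite !ltnn !orbF => ->.
Qed.

Lemma imode0l k n w2 : imode Y k 0 n w2 = 0.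
Proof. exact: linfun0 (int_linear_l Y k n w2). Qed.

Lemma imode0r k w1 n : imode Y k w1 n 0 = 0.
Proof. exact: linfun0 (int_linear_r Y k w1 n). Qed.

(** As a + b = -1 - r1/T1 - r2/T2, the term of the Jacobi identity where modes of [v] act on U lies
    in C_1(U) by [C1_twist]; the two other terms add up to it. *)
Lemma int_relation r1 r2 (m1 m2 : int) n v w1 w2 :
  (r1 < T1)%N -> (r2 < T2)%N -> m1 + m2 = - 1 -> 0 <= n ->
  [|| 0 < n, (0 < r1)%N | (0 < r2)%N] -> vwt n v ->
  eigen g1 T1 r1 v -> eigen g2 T2 r2 v ->
  let b : R := m1%:~R - r1%:R / T1%:R in
  let a : R := m2%:~R - r2%:R / T2%:R in
  exists J : nat, forall k e, C1 U
    (\sum_(j < J.+1) (gbinom a j)%:C%C *: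
       coef (imode Y k) (wmode v (b%:C%C + j%:R) w1) (e - a%:C%C + j%:R) w2
     + \sum_(j < J.+1) delta_coef false true false b j *:
       coef (imode Y k) w1 (e - b%:C%C + j%:R) (wmode v (a%:C%C + j%:R) w2)).
Proof.
move=> r1T r2T m12 n0 nr vn v1 v2 b a.
have bE : b%:C%C = m1%:~R - r1%:R / T1%:R.
  by rewrite rmorphB/= rmorph_int fmorph_div/= !rmorph_nat.
have aE : a%:C%C = m2%:~R - r2%:R / T2%:R.
  by rewrite rmorphB/= rmorph_int fmorph_div/= !rmorph_nat.
have [J1 hJ1] := wmode_eventually0 T1_gt0 w1 m1 r1T v1.
have [J2 hJ2] := wmode_eventually0 T2_gt0 w2 m2 r2T v2.
exists (maxn J1 J2) => k e; set J := (maxn J1 J2).+1.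
(* These exponents of x0 and x1 select the power [b] of x1 - x2 and the power [a] of x2 + x0. *)
have := int_jacobi Y w1 w2 k (- 1 - b%:C%C) (- 1 - a%:C%C) e r1T r2T v1 v2.
have [N hN] := int_truncation Y w1 w2 (- e - 1).
rewrite (delta_mulE (beta := b) (n := m1) (J := N))//; first last.
- move=> j Nj; right; rewrite const_coef0 /coef.
  by rewrite (_ : - (e - _) - 1 = - e - 1 + j%:R) ?hN ?wmode0//; ring.
- by move=> x y z x0; rewrite const_coef_neq.
rewrite (delta_mulE (beta := b) (n := m1) (J := J))//; first last.
- move=> j Jj; right; rewrite const_coef0 /coef.
  rewrite (_ : - (_ - j%:R) - 1 = a%:C%C + j%:R); last by ring.
  by rewrite aE hJ2 ?imode0r//; rewrite /J in Jj; lia.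
- by move=> x y z x0; rewrite const_coef_neq.
rewrite (delta_mulE (beta := a) (n := m2) (J := J))//; first last.
- move=> j Jj; right; rewrite const_coef0 /coef.
  rewrite (_ : - (_ - j%:R) - 1 = b%:C%C + j%:R); last by ring.
  by rewrite bE hJ1 ?imode0l//; rewrite /J in Jj; lia.
- by move=> x y z x0; rewrite const_coef_neq.
move=> /eqP; rewrite subr_eq eq_sym.
under eq_bigr do rewrite delta_coef_fff const_coef0.
under [X in _ + X == _]eq_bigr do rewrite const_coef0.
under [X in _ == X]eq_bigr do rewrite const_coef0.
move=> /eqP E.
set X := _ + _; suff -> : X = \sum_(j < N) delta_coef false false true b j *:
    coef (wmode (t:=U)) v (- 1 - a%:C%C - b%:C%C + j%:R)
      (coef (imode Y k) w1 (e - j%:R) w2).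
  apply: subspace_sum (C1_subspace U) _ => j _.
  apply: subspaceZ (C1_subspace U) _; rewrite /coef.
  have := C1_twist j (imode Y k w1 (- (e - j%:R) - 1) w2) n0 nr vn v1 v2.
  congr (C1 U (wmode _ _ _)); rewrite bE aE.
  have /(congr1 (fun m : int => m%:~R : R[i])) := m12.
  rewrite rmorphD/= mulrNz => m12C.
  rewrite (_ : m2%:~R = -1 - m1%:~R); last by rewrite -m12C; ring.
  by ring.
rewrite -E /X; congr (_ + _); apply: eq_bigr => j _; congr (_ *: _);
  rewrite /coef.
  by congr (imode Y k (wmode v _ _) _ _); ring.
by congr (imode Y k _ _ (wmode v _ _)); ring.
Qed.


(** * Values at x = 1 in finitely many weights *)

Section Evaluation.
Variable Lam : seq R[i].

(* For w1, w2 of weights adding up to s, the x^(l-s) coefficient has weight l: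
   this is the part of Y(w1, x) w2 of weights in Lam, free of log x, at
   x = 1. *)
Definition evaluation (s : R[i]) (w1 : W1) (w2 : W2) : U :=
  \sum_(l <- Lam) coef (imode Y 0) w1 (l - s) w2.

Lemma evaluation_linearl s w2 : linear (fun w1 => evaluation s w1 w2).
Proof.
move=> a u v; rewrite /evaluation scaler_sumr -big_split; apply: eq_bigr => l _.
exact: int_linear_l.
Qed.

Lemma evaluation_linearr s w1 : linear (evaluation s w1).
Proof.
move=> a u v; rewrite /evaluation scaler_sumr -big_split; apply: eq_bigr => l _.
exact: int_linear_r.
Qed.

(** When [w1] and [w2] have weights adding up to s - n + 1, each evaluation carries the total weight
    of its two arguments, so all terms are cut to the same weights of U. Nonzero leading
    coefficients allow solving for either term j = 0. *)
Lemma evaluation_relation r1 r2 (m1 m2 : int) n v w1 w2 s :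
  (r1 < T1)%N -> (r2 < T2)%N -> m1 + m2 = - 1 -> 0 <= n ->
  [|| 0 < n, (0 < r1)%N | (0 < r2)%N] -> vwt n v ->
  eigen g1 T1 r1 v -> eigen g2 T2 r2 v ->
  let b : R[i] := m1%:~R - r1%:R / T1%:R in
  let a : R[i] := m2%:~R - r2%:R / T2%:R in
  exists (J : nat) (x y : nat -> R[i]), [/\ x 0%N = 1, y 0%N != 0
    & C1 U
    (\sum_(j < J.+1) x j *: evaluation (s - b - j%:R) (wmode v (b + j%:R) w1) w2
     + \sum_(j < J.+1) y j *:
       evaluation (s - a - j%:R) w1 (wmode v (a + j%:R) w2))].
Proof.
move=> r1T r2T m12 n0 nr vn v1 v2 b a.
have bE : (m1%:~R - r1%:R / T1%:R : R)%:C%C = b.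
  by rewrite rmorphB/= rmorph_int fmorph_div/= !rmorph_nat.
have aE : (m2%:~R - r2%:R / T2%:R : R)%:C%C = a.
  by rewrite rmorphB/= rmorph_int fmorph_div/= !rmorph_nat.
have [J hJ] := int_relation w1 w2 r1T r2T m12 n0 nr vn v1 v2.
exists J, (fun j => (gbinom (m2%:~R - r2%:R / T2%:R : R) j)%:C%C),
  (delta_coef false true false (m1%:~R - r1%:R / T1%:R)); split.
- by rewrite gbinom0 rmorph1.
- by rewrite /delta_coef gbinom0 /= !mulr1 rmorph1 mul1r exp_ipi_neq0.
under eq_bigr do rewrite /evaluation scaler_sumr.
under [X in _ + X]eq_bigr do rewrite /evaluation scaler_sumr.
rewrite exchange_big [X in _ + X]exchange_big -big_split/=.
apply: subspace_sum (C1_subspace U) _ => l _.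
have := hJ 0%N (l - s + b + a); rewrite bE aE; congr (C1 U (_ + _)).
  by apply: eq_bigr => j _; congr (_ *: coef _ _ _ _); ring.
by apply: eq_bigr => j _; congr (_ *: coef _ _ _ _); ring.
Qed.

Variable S : set U.
Hypotheses (hS : is_subspace S) (C1S : C1 U `<=` S).

(** With m1 = -1 and m2 = 0, the term solved for contains a generator of C_1(W1). *)
Lemma evaluation_reduce1 r1 r2 (m1 m2 : int) n v w1 w2 s :
  (r1 < T1)%N -> (r2 < T2)%N -> m1 + m2 = - 1 -> 0 <= n ->
  [|| 0 < n, (0 < r1)%N | (0 < r2)%N] -> vwt n v ->
  eigen g1 T1 r1 v -> eigen g2 T2 r2 v ->
  let b : R[i] := m1%:~R - r1%:R / T1%:R in
  let a : R[i] := m2%:~R - r2%:R / T2%:R in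
  (forall j : nat,
    S (evaluation (s - b - j.+1%:R) (wmode v (b + j.+1%:R) w1) w2)) ->
  (forall j : nat, S (evaluation (s - a - j%:R) w1 (wmode v (a + j%:R) w2))) ->
  S (evaluation (s - b) (wmode v b w1) w2).
Proof.
move=> r1T r2T m12 n0 nr vn v1 v2 b a Sb Sa.
have [J [x [y [x0 _]]]] :=
  evaluation_relation w1 w2 s r1T r2T m12 n0 nr vn v1 v2.
move/C1S; rewrite -/b -/a big_ord_recl x0 scale1r subr0 addr0 -addrA.
apply: subspaceDl hS _; apply: subspaceD => //;
  apply: subspace_sum => // j _; apply: subspaceZ => //;
      first [exact: Sb|exact: Sa].
Qed.

(** With m1 = 0 and m2 = -1, the term solved for contains a generator of C_1(W2); its coefficient is
    the phase e^(pi i b). *)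
Lemma evaluation_reduce2 r1 r2 (m1 m2 : int) n v w1 w2 s :
  (r1 < T1)%N -> (r2 < T2)%N -> m1 + m2 = - 1 -> 0 <= n ->
  [|| 0 < n, (0 < r1)%N | (0 < r2)%N] -> vwt n v ->
  eigen g1 T1 r1 v -> eigen g2 T2 r2 v ->
  let b : R[i] := m1%:~R - r1%:R / T1%:R in
  let a : R[i] := m2%:~R - r2%:R / T2%:R in
  (forall j : nat, S (evaluation (s - b - j%:R) (wmode v (b + j%:R) w1) w2)) ->
  (forall j : nat,
    S (evaluation (s - a - j.+1%:R) w1 (wmode v (a + j.+1%:R) w2))) ->
  S (evaluation (s - a) w1 (wmode v a w2)).
Proof.
move=> r1T r2T m12 n0 nr vn v1 v2 b a Sb Sa.
have [J [x [y [_ y0]]]] :=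
  evaluation_relation w1 w2 s r1T r2T m12 n0 nr vn v1 v2.
move/C1S; rewrite -/b -/a addrC big_ord_recl subr0 addr0 -addrA => Sy.
have : S (y 0%N *: evaluation (s - a) w1 (wmode v a w2)).
  apply: subspaceDl hS _ Sy; apply: subspaceD => //;
    apply: subspace_sum => // j _; apply: subspaceZ => //;
      first [exact: Sb|exact: Sa].
by move/(subspaceZ (y 0%N)^-1 hS); rewrite scalerA mulVf// scale1r.
Qed.

Context {d1 d2 : nat} (b1 : 'I_d1 -> W1) (b2 : 'I_d2 -> W2).
Context (beta1 : 'I_d1 -> R[i]) (beta2 : 'I_d2 -> R[i]).
Hypotheses (dW1 : direct_sum (gen_weight W1)).
Hypotheses (dW2 : direct_sum (gen_weight W2)).
Hypotheses (bw1 : forall i, gen_weight W1 (beta1 i) (b1 i)).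
Hypotheses (bw2 : forall i, gen_weight W2 (beta2 i) (b2 i)).
Hypotheses (bS1 : forall w, span_mod (C1 W1) b1 w).
Hypotheses (bS2 : forall w, span_mod (C1 W2) b2 w).
Hypothesis Sb : forall i j, S (evaluation (beta1 i + beta2 j) (b1 i) (b2 j)).

(** * Descent on the total weight within a pair of weight cosets *)

Section Coset.
Variables (mu1 mu2 : R[i]) (N1 N2 : int).
Hypotheses (hN1 : forall n : int, n <= N1 ->
  gen_weight W1 (mu1 + n%:~R / T1%:R) = [set 0]).
Hypotheses (hN2 : forall n : int, n <= N2 ->
  gen_weight W2 (mu2 + n%:~R / T2%:R) = [set 0]).

(* The weights only drop by multiples of 1/T1 and 1/T2; n1 * T2 + n2 * T1 is
   T1 * T2 times the total weight, relative to (mu1, mu2). *)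
Lemma evaluation_mem_coset (M : nat) (n1 n2 : int) w1 w2 :
  (n1 - N1) * T2%:Z + (n2 - N2) * T1%:Z <= M%:Z ->
  gen_weight W1 (mu1 + n1%:~R / T1%:R) w1 ->
  gen_weight W2 (mu2 + n2%:~R / T2%:R) w2 ->
  S (evaluation (mu1 + n1%:~R / T1%:R + (mu2 + n2%:~R / T2%:R)) w1 w2).
Proof.
have T10 : T1%:R != 0 :> R[i] by rewrite pnatr_eq0 -lt0n.
have T20 : T2%:R != 0 :> R[i] by rewrite pnatr_eq0 -lt0n.
have shift (T : nat) (m k : int) : T%:R != 0 :> R[i] ->
    (m + T%:Z * k)%:~R / T%:R = m%:~R / T%:R + k%:~R :> R[i].
  by move=> T0; rewrite rmorphD rmorphM/= mulrDl mulrAC divff// mul1r.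
(* At or below [N1] or [N2] a vector vanishes; above both, the measure is positive, which excludes M
   = 0. *)
elim: M n1 n2 w1 w2 => [|M IH] n1 n2 w1 w2 nM w1n w2n;
  (have [n1N|n1N] := leP n1 N1; first by
    move: w1n; rewrite hN1// => ->; rewrite (linfun0 (evaluation_linearl _ _));
    exact: subspace0);
  (have [n2N|n2N] := leP n2 N2; first by
    move: w2n; rewrite hN2// => ->; rewrite (linfun0 (evaluation_linearr _ _));
    exact: subspace0).
  have : 0 < (n1 - N1) * T2%:Z by rewrite mulr_gt0 ?subr_gt0.
  have : 0 < (n2 - N2) * T1%:Z by rewrite mulr_gt0 ?subr_gt0.
  lia.
have [_ iter1 _] := hT1; have [_ iter2 _] := hT2.
have {}IH k1 k2 l1 l2 s x1 x2 : (k1 - N1) * T2%:Z + (k2 - N2) * T1%:Z <= M%:Z ->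
    l1 = mu1 + k1%:~R / T1%:R -> l2 = mu2 + k2%:~R / T2%:R -> s = l1 + l2 ->
    gen_weight W1 l1 x1 -> gen_weight W2 l2 x2 -> S (evaluation s x1 x2).
  by move=> + -> -> ->; exact: IH.
have sp2 := homogeneous_generator_span hg2 T2_gt0 hg1 T1_gt0 iter1
  (fun v => esym (hcomm v)) dW2 bw2 bS2 w2n.
apply: (linear_lspan (evaluation_linearr _ _) hS _ sp2) => {sp2} u2.
move=> [[i2 [e2 ->]]|]; last first.
  move=> [r2 [r1 [n [v [l [w [[r2T r1T n0 nr] [vn v2 v1 wl [lE ->]]]]]]]]].
  have nr' : [|| 0 < n, (0 < r1)%N | (0 < r2)%N].
    by case/orP: nr => ->; rewrite ?orbT.
  (* Pairing v_(j - r1/T1) w1 with [w] changes the measure by r1 T2 - r2 T1 - (j+1) T1 T2, which is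
     negative because r1 < T1. *)
  have rT : (r1 * T2 + T2 <= T1 * T2)%N by rewrite -mulSnr leq_mul2r r1T orbT.
  have lE' : l = mu2 + n2%:~R / T2%:R - n%:~R - r2%:R / T2%:R.
    by rewrite lE; ring.
  pose s := mu1 + n1%:~R / T1%:R + l + n%:~R - 1.
  have := @evaluation_reduce2 r1 r2 0 (-1) n v w1 w s
    r1T r2T (add0r _) n0 nr' vn v1 v2.
  rewrite /= mulr0z mulrNz mulr1z sub0r.
  rewrite (_ : s - (- 1 - _) = mu1 + n1%:~R / T1%:R + (mu2 + n2%:~R / T2%:R));
    last by rewrite lE /s; ring.
  apply=> j.
    rewrite (_ : - _ + j%:R = j%:Z%:~R - r1%:R / T1%:R); last by ring.
    apply: (IH (n1 + r1%:Z + T1%:Z * (n - j%:Z - 1))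
      (n2 - r2%:Z + T2%:Z * (- n)) _ _ _ _ _ _ _ _ _
      (wmode_weight hg1 T1_gt0 j%:Z r1T v1 vn w1n) wl).
    - nia.
    - by rewrite shift// !(rmorphD, rmorphN)/=; ring.
    - by rewrite shift// lE' !(rmorphD, rmorphN)/=; ring.
    - by rewrite /s; ring.
  rewrite (_ : - 1 - _ + j.+1%:R = j%:Z%:~R - r2%:R / T2%:R); last first.
    by rewrite -natr1; ring.
  apply: (IH n1 (n2 + T2%:Z * (- (j%:Z + 1))) _ _ _ _ _ _ _ _ _ w1n
    (wmode_weight hg2 T2_gt0 j%:Z r2T v2 vn wl)) => //.
  - nia.
  - by rewrite shift// lE' !(rmorphD, rmorphN)/=; ring.
  - by rewrite lE' -natr1; ring.
have sp1 := homogeneous_generator_span hg1 T1_gt0 hg2 T2_gt0 iter2 hcomm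
  dW1 bw1 bS1 w1n.
apply: (linear_lspan (evaluation_linearl _ _) hS _ sp1) => {sp1} u1.
move=> [[i1 [e1 ->]]|]; first by rewrite e1 e2; exact: Sb.
move=> [r1 [r2 [n [v [l [w [[r1T r2T n0 nr] [vn v1 v2 wl [lE ->]]]]]]]]].
have b2n : gen_weight W2 (mu2 + n2%:~R / T2%:R) (b2 i2) by rewrite e2.
have nr' : [|| 0 < n, (0 < r1)%N | (0 < r2)%N].
  by case/orP: nr => ->; rewrite ?orbT.
have rT : (r2 * T1 + T1 <= T1 * T2)%N.
  by rewrite -mulSnr mulnC leq_mul2l r2T orbT.
have lE' : l = mu1 + n1%:~R / T1%:R - n%:~R - r1%:R / T1%:R by rewrite lE; ring.
pose s := l + (mu2 + n2%:~R / T2%:R) + n%:~R - 1.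
have := @evaluation_reduce1 r1 r2 (-1) 0 n v w (b2 i2) s
  r1T r2T (addr0 _) n0 nr' vn v1 v2.
rewrite /= mulr0z mulrNz mulr1z sub0r.
rewrite (_ : s - (- 1 - _) = mu1 + n1%:~R / T1%:R + (mu2 + n2%:~R / T2%:R));
  last by rewrite lE /s; ring.
apply=> j.
  rewrite (_ : - 1 - _ + j.+1%:R = j%:Z%:~R - r1%:R / T1%:R); last first.
    by rewrite -natr1; ring.
  apply: (IH (n1 + T1%:Z * (- (j%:Z + 1))) n2 _ _ _ _ _ _ _ _ _
    (wmode_weight hg1 T1_gt0 j%:Z r1T v1 vn wl) b2n) => //.
  - nia.
  - by rewrite shift// lE' !(rmorphD, rmorphN)/=; ring.
  - by rewrite lE' -natr1; ring.
rewrite (_ : - _ + j%:R = j%:Z%:~R - r2%:R / T2%:R); last by ring.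
apply: (IH (n1 - r1%:Z + T1%:Z * (- n)) (n2 + r2%:Z + T2%:Z * (n - j%:Z - 1))
  _ _ _ _ _ _ _ _ _ wl (wmode_weight hg2 T2_gt0 j%:Z r2T v2 vn b2n)).
- nia.
- by rewrite shift// lE' !(rmorphD, rmorphN)/=; ring.
- by rewrite shift// !(rmorphD, rmorphN)/=; ring.
- by rewrite /s; ring.
Qed.

End Coset.

Hypotheses (hW1 : generalized W1) (hW2 : generalized W2).

Lemma evaluation_mem l1 l2 w1 w2 : gen_weight W1 l1 w1 -> gen_weight W2 l2 w2 ->
  S (evaluation (l1 + l2) w1 w2).
Proof.
move=> w1l w2l; have [N1 hN1] := hW1.2 l1; have [N2 hN2] := hW2.2 l2.
have := evaluation_mem_coset hN1 hN2 (n1 := 0) (n2 := 0) (w1 := w1) (w2 := w2).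
rewrite !mulr0z !mul0r !addr0; apply; [|exact: w1l|exact: w2l].
exact: lez_abs.
Qed.

(** Applying x d/dx to x^(l1+l2) Y(w1, x) w2 gives l1+l2 times it plus the same series for L(-1)w1,
    of weight l1+1. Hence all iterates at x = 1 are combinations of evaluations, and
    [log_separation] isolates each coefficient. *)
Lemma coef_mem l1 l2 w1 w2 l k : uniq Lam ->
  gen_weight W1 l1 w1 -> gen_weight W2 l2 w2 -> l \in Lam ->
  S (coef (imode Y k) w1 (l - (l1 + l2)) w2).
Proof.
move=> uLam w1l w2l lL.
pose c l0 w (m : R[i]) (p : nat) := coef (imode Y p) w (m - (l0 + l2)) w2.
apply: (log_separation (c := c l1 w1) hS uLam) lL.
  by move=> m; exact: int_log.
move=> i; elim: i l1 w1 w1l => [|i IH] l1' w w_l; first exact: evaluation_mem.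
have cE : log_derive (c l1' w) = fun m p =>
    (l1' + l2) *: c l1' w m p + c (l1' + 1) (wvir (-1) w) m p.
  apply/funext => m; apply/funext => p.
  rewrite /log_derive /c /coef int_Lm1.
  rewrite (_ : - (m - (l1' + 1 + l2)) - 1 - 1 = - (m - (l1' + l2)) - 1);
    last by ring.
  by rewrite addrA -scalerDl; congr (_ *: _ + _); ring.
rewrite iterSr cE iter_log_derive_linear big_split/= -scaler_sumr.
apply: hS.2; first exact: IH.
by apply: IH; exact: wvir_Lm1_weight.
Qed.

End Evaluation.

Definition weights_in (Lam : seq R[i]) : set U :=
  [set u | exists k l1 l2 w1 w2 l, [/\ gen_weight W1 l1 w1, gen_weight W2 l2 w2,
    l \in Lam & u = coef (imode Y k) w1 (l - (l1 + l2)) w2]].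

Lemma lspan_weights_inS (Lam Lam' : seq R[i]) : {subset Lam <= Lam'} ->
  lspan (weights_in Lam) `<=` lspan (weights_in Lam').
Proof.
move=> LL; apply: lspan_sub (lspan_subspace _) _.
move=> _ [k [l1 [l2 [w1 [w2 [l [w1l w2l lL ->]]]]]]]; apply: sub_lspan.
by exists k, l1, l2, w1, w2, l; split=> //; exact: LL.
Qed.

Hypotheses (hW1 : generalized W1) (hW2 : generalized W2).
Hypothesis hY : surjective_int Y.

(** By surjectivity [u] is a finite combination of coefficients. Splitting their arguments by weight
    gives each coefficient the formal weight l1 + l2 - n - 1. *)
Lemma ex_weights_in (u : U) : exists Lam, lspan (weights_in Lam) u.
Proof.
have : int_image Y u by rewrite hY.
pose A : set U := [set u | exists Lam, lspan (weights_in Lam) u].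
have hA : is_subspace A.
  split=> [|a x y [L1 L1x] [L2 L2y]].
    by exists [::]; exact: subspace0 (lspan_subspace _).
  exists (L1 ++ L2); apply: (lspan_subspace _).2.
    by apply: lspan_weights_inS L1x => l; rewrite mem_cat => ->.
  by apply: lspan_weights_inS L2y => l; rewrite mem_cat orbC => ->.
apply: (lspan_sub hA) => _ [k [w1 [n [w2 ->]]]].
have sp1 : lspan (\bigcup_l gen_weight W1 l) w1.
  by rewrite (homogeneous_span hW1.1).
apply: (linear_lspan (int_linear_l Y k n w2) hA _ sp1) => {sp1} {}w1 [l1 _ w1l].
have sp2 : lspan (\bigcup_l gen_weight W2 l) w2.
  by rewrite (homogeneous_span hW2.1).
apply: (linear_lspan (int_linear_r Y k w1 n) hA _ sp2) => {sp2} {}w2 [l2 _ w2l].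
exists [:: l1 + l2 - n - 1]; apply: sub_lspan.
exists k, l1, l2, w1, w2, (l1 + l2 - n - 1); split=> //; first by rewrite inE.
by rewrite /coef; congr (imode Y _ _ _ _); ring.
Qed.

Lemma fusion_dim_leq : C1_cofinite W1 -> C1_cofinite W2 ->
  (dim_mod_C1 U <= dim_mod_C1 W1 * dim_mod_C1 W2)%N /\ C1_cofinite U.
Proof.
move=> hC1 hC2.
have [d1 [b1 [d1le hb1 bS1]]] :=
  ex_basis_mod_in (C1_subspace W1) hC1 (homogeneous_span hW1.1).
have [d2 [b2 [d2le hb2 bS2]]] :=
  ex_basis_mod_in (C1_subspace W2) hC2 (homogeneous_span hW2.1).
have /choice[beta1 bw1] i : exists l, gen_weight W1 l (b1 i).
  by have [l _ ?] := hb1 i; exists l.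
have /choice[beta2 bw2] i : exists l, gen_weight W2 l (b2 i).
  by have [l _ ?] := hb2 i; exists l.
suff : forall n (u : 'I_n -> U), indep_mod (C1 U) u ->
    (n <= dim_mod_C1 W1 * dim_mod_C1 W2)%N.
  by move=> /(quotient_dim_leq (C1_subspace U))[].
move=> n u iu; apply: leq_trans (leq_mul d1le d2le).
have /choice[L hL] := fun i => ex_weights_in (u i).
(* One list serves the whole family; separating exponents requires it to be free of duplicates. *)
pose Lam := undup (flatten [seq L i | i <- enum 'I_n]).
(* These vectors depend on [Lam], hence on the family [u]; only their number [d1 * d2] enters the
   bound. *)
pose e (i : 'I_#|{: 'I_d1 * 'I_d2}|) := let p := enum_val i in
  evaluation Lam (beta1 p.1 + beta2 p.2) (b1 p.1) (b2 p.2).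
rewrite -[d1]card_ord -[d2]card_ord -card_prod.
apply: (indep_mod_leq (C1_subspace U) (b := e)) iu _ => i.
apply: (lspan_sub (A := weights_in Lam)
  (span_mod_subspace (C1_subspace U) e)); last first.
  apply: lspan_weights_inS (hL i) => l li; rewrite mem_undup.
  by apply/flatten_mapP; exists i; rewrite ?mem_enum.
move=> _ [k [l1 [l2 [w1 [w2 [l [w1l w2l lL ->]]]]]]].
apply: (coef_mem (span_mod_subspace (C1_subspace U) e) _ hW1.1 hW2.1 bw1 bw2
  bS1 bS2 _ hW1 hW2 k _ w1l w2l lL).
- exact: sub_span_mod.
- move=> i1 i2.
  have := mem_span_mod (C1_subspace U) e (enum_rank (i1, i2)).
  by rewrite /e enum_rankK.
- exact: undup_uniq.
Qed.

End Intertwining.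

Theorem theorem1 (R : realType) (V : voa R) (g1 g2 : V -> V) (T1 T2 T3 : nat)
  (hg1 : voa_automorphism g1) (hg2 : voa_automorphism g2)
  (hcomm : forall v : V, g1 (g2 v) = g2 (g1 v))
  (hT1 : has_order g1 T1) (hT2 : has_order g2 T2)
  (hT3 : has_order (g1 \o g2) T3)
  (W1 : twisted_module g1 T1) (W2 : twisted_module g2 T2)
  (hW1 : generalized W1) (hW2 : generalized W2)
  (hC1 : C1_cofinite W1) (hC2 : C1_cofinite W2)
  (U : twisted_module (g1 \o g2) T3) (hU : generalized U)
  (Y : intertwining W1 W2 U) (hY : surjective_int Y) :
  (dim_mod_C1 U <= dim_mod_C1 W1 * dim_mod_C1 W2)%N /\ C1_cofinite U.
Proof.
exact: (fusion_dim_leq hg1 hg2 hcomm hT1 hT2 hT3 hW1 hW2 hY hC1 hC2).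
Qed.
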